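(* Let $G$ be an outerplanar graph with maximum degree $\Delta=\Delta(G)$ and girth $g(G)$. Then: (a) if $\Delta\geq 4$ and $g(G)\geq 4$, then $\chi_{vi,1}(G)\leq \Delta+3$; (b) if $\Delta\geq 4$ and $g(G)\geq 6$, then $\chi_{vi,1}(G)\leq \Delta+2$; (c) if $\Delta\geq 5$ and $g(G)\geq 4$, then $\chi_{vi,1}(G)\leq\Delta+2$. In cases (b) and (c), consequently $\chi_{vi,1}(G)=\Delta+2$.
   Context: All graphs are finite, simple and undirected. An incidence of $G$ is a pair $(v,e)$ with $v\in V(G)$, $e\in E(G)$, $v\in e$; $I(G)$ denotes the set of incidences. Let $G^{1/3}$ be the graph obtained from $G$ by replacing each edge $e=\{u,v\}$ by the path $u,(u,e),(v,e),v$. A $vi$-simultaneous proper $k$-coloring of $G$ is a map $c:V(G)\cup I(G)\to\{1,\dots,k\}$ such that any two distinct elements at distance at most $3$ in $G^{1/3}$ receive distinct colors. For a vertex $v$, $I_2(v)=\{(u,\{u,v\}) : u\in N_G(v)\}$. Such a coloring is a $(k,s)$-coloring if for every vertex $v$ at most $s$ distinct colors appear on $I_2(v)$; $\chi_{vi,s}(G)$ is the least such $k$. Note that always $\chi_{vi,s}(G)\ge\Delta(G)+2$. The girth $g(G)$ is the length of a shortest cycle in $G$. A graph is outerplanar if it has a planar drawing with all vertices on the outer face. *)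

(* Defs.v *)
From HB Require Import structures.
From mathcomp Require Import all_boot all_order all_algebra.
From mathcomp Require Import all_classical all_reals all_analysis.

Set Implicit Arguments.
Unset Strict Implicit.
Unset Printing Implicit Defensive.

Import Order.TTheory GRing.Theory Num.Theory.
Import numFieldNormedType.Exports.

Record sgraph := SGraph {
  vertex :> finType;
  adj : rel vertex;
  adj_sym : symmetric adj;
  adj_irrefl : irreflexive adj
}.

Section Graphs.
Variable G : sgraph.

Definition edges : {set {set G}} :=
  [set [set p.1; p.2]%SET | p in [set p : G * G | adj p.1 p.2]%SET]%SET.

Definition neighbors (v : G) : {set G} := [set u | adj v u]%SET.

Definition max_degree : nat := \max_(v : G) #|neighbors v|.

Definition is_cycle (c : seq G) : bool :=
  [&& 3 <= size c, uniq c & cycle (@adj G) c].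

Definition is_incidence (p : G * {set G}) : bool :=
  (p.2 \in edges) && (p.1 \in p.2).

Definition incidence : finType := {p : G * {set G} | is_incidence p}.

Definition inc_vertex (i : incidence) : G := (val i).1.
Definition inc_edge (i : incidence) : {set G} := (val i).2.

(* The vertices of G^(1/3), which are also the elements to be coloured. *)
Definition element : finType := (G + incidence)%type.

(* Adjacency in G^(1/3): each edge e = {u, v} becomes the path
   u, (u, e), (v, e), v. *)
Definition third_adj : rel element := fun x y =>
  match x, y with
  | inl _, inl _ => false
  | inl u, inr i | inr i, inl u => inc_vertex i == u
  | inr i, inr j => (inc_edge i == inc_edge j) && (i != j)
  end.

Definition dist_le (T : eqType) (r : rel T) (n : nat) (x y : T) : Prop :=
  exists p : seq T, [/\ path r x p, last x p = y & size p <= n].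

Definition vi_proper (k : nat) (c : element -> 'I_k) : Prop :=
  forall x y : element, x != y -> dist_le third_adj 3 x y -> c x != c y.

Definition I2 (v : G) : {set incidence} :=
  [set i | (inc_vertex i \in neighbors v)
           && (inc_edge i == [set inc_vertex i; v]%SET)]%SET.

Definition ks_coloring (k s : nat) (c : element -> 'I_k) : Prop :=
  vi_proper c /\
  forall v : G, #|[set c (inr i) | i in I2 v]%SET| <= s.

Definition ks_colorable (s k : nat) : Prop :=
  exists c : element -> 'I_k, ks_coloring s c.

End Graphs.

(* The value 0 is a placeholder for the case where no (k, s)-coloring exists
   at all; by [ks_colorable_ex] this never happens when 0 < s. *)
Definition chi_vi (s : nat) (G : sgraph) : nat :=
  match pselect (exists k, `[< ks_colorable G s k >]) with
  | left h => ex_minn h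
  | right _ => 0
  end.

Section ChiExists.
Variable G : sgraph.

(* The endpoint of the edge of i which is not the vertex of i. *)
Let other (i : incidence G) : G :=
  odflt (inc_vertex i) [pick w in inc_edge i | w != inc_vertex i].

Let otherP (i : incidence G) :
  inc_edge i = [set inc_vertex i; other i]%SET /\ other i != inc_vertex i.
Proof.
have /andP[/imsetP[[u v] /=]] := valP i; rewrite inE /= => uv.
rewrite -/(inc_edge i) -/(inc_vertex i) => ei.
have neq_uv : u != v by apply: contraTneq uv => ->; rewrite adj_irrefl.
rewrite ei => ui; rewrite /other ei.
case: pickP => [w /andP[wi wNi] /=|none].
- split=> //; move: ui wi wNi; rewrite !inE.
  by case/orP=> /eqP-> /orP[] /eqP->; rewrite ?eqxx // => _; rewrite finset.setUC.
- move: ui; rewrite !inE => /orP[] /eqP iE.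
  + by move: (none v); rewrite !inE iE eqxx orbT eq_sym neq_uv.
  + by move: (none u); rewrite !inE iE eqxx neq_uv.
Qed.

Let code (x : element G) : G + G :=
  match x with inl v => inl v | inr i => inr (other i) end.

Let code_far (x y : element G) :
  x != y -> dist_le (@third_adj G) 3 x y -> code x != code y.
Proof.
move=> xy [p [pth lst sz]]; apply/eqP => exy.
case: x y xy exy pth lst => [u|i] [v|j] //= xy; first by case=> uv; rewrite uv eqxx in xy.
case=> oij pth lst.
have [ei oi] := otherP i; have [ej oj] := otherP j.
have nij : inc_vertex i != inc_vertex j.
  apply: contraNneq xy => vij; apply/eqP; congr inr; apply/val_inj.
  rewrite [LHS]surjective_pairing [RHS]surjective_pairing.
  by rewrite -!/(inc_vertex _) -!/(inc_edge _) ei ej vij oij.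
have nE : inc_edge i != inc_edge j.
  apply/eqP => eij; have : inc_vertex i \in inc_edge j by rewrite -eij ei !inE eqxx.
  by rewrite ej !inE (negPf nij) -oij eq_sym (negPf oi).
have nbr k (z : element G) : third_adj (inr k) z ->
    z = inl (inc_vertex k) \/
    exists l, [/\ z = inr l, inc_edge l = inc_edge k & inc_vertex l = other k].
  case: z => [w /= /eqP<-|l /= /andP[/eqP ekl kl]]; [by left|right].
  exists l; split=> //; have [ek ok] := otherP k.
  have /andP[_] := valP l; rewrite -/(inc_edge l) -/(inc_vertex l) -ekl ek.
  rewrite !inE => /orP[] /eqP // vlk; case/eqP: kl; apply/val_inj.
  rewrite [LHS]surjective_pairing [RHS]surjective_pairing.
  by rewrite -!/(inc_vertex _) -!/(inc_edge _) ekl vlk.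
have sym (a b : element G) : third_adj a b = third_adj b a.
  by case: a b => [a|a] [b|b] //=; rewrite eq_sym; congr (_ && ~~ _); rewrite eq_sym.
have apart (a b : element G) : third_adj (inr i) a -> third_adj (inr j) b ->
    a != b /\ ~~ third_adj a b.
  case/nbr=> [->|[k [-> ek vk]]]; case/nbr=> [->|[l [-> el vl]]] /=.
  - by split=> //; apply: contraNneq nij => -[].
  - by split=> //; rewrite vl -oij.
  - by split=> //; rewrite vk oij.
  - rewrite ek el (negPf nE); split=> //.
    by apply: contraNneq nE => -[kl]; rewrite -ek -el kl.
case: p pth lst sz => [|a [|b [|c []]]] //=.
- by move=> _ eij; rewrite eij eqxx in xy.
- by move=> /andP[ia _] aj; move: ia; rewrite aj /= (negPf nE).
- move=> /and3P[ia ab _] bj; move: ab; rewrite bj sym => ja _.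
  by case: (apart _ _ ia ja); rewrite eqxx.
- move=> /and4P[ia ab bc _] cj; move: bc; rewrite cj sym => jb _.
  by case: (apart _ _ ia jb) => _; rewrite ab.
Qed.

Lemma ks_colorable_ex (s : nat) : 0 < s -> exists k, ks_colorable G s k.
Proof.
move=> s_gt0; exists #|{: G + G}|.
exists (fun x => enum_rank (code x)); split=> [x y xy dxy|v].
  by apply: contra_neq (code_far xy dxy) => /enum_rank_inj.
apply: (leq_trans _ s_gt0).
rewrite -(cards1 (enum_rank (inr v : G + G))); apply/subset_leq_card/fintype.subsetP.
move=> _ /imsetP[i iv ->]; rewrite !inE /=; apply/eqP; do 2 congr (_ _).
move: iv; rewrite inE => /andP[_ /eqP ev]; have [eo oi] := otherP i.
have : other i \in inc_edge i by rewrite eo !inE eqxx orbT.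
by rewrite ev !inE (negPf oi) => /eqP.
Qed.

Lemma chi_viP (s : nat) : 0 < s ->
  ks_colorable G s (chi_vi s G) /\
  forall k, ks_colorable G s k -> chi_vi s G <= k.
Proof.
move=> /ks_colorable_ex[k0 k0P]; rewrite /chi_vi; case: pselect => [h|[]].
  by case: ex_minnP => m /asboolP mP m_min; split=> // k kP; apply/m_min/asboolP.
by exists k0; apply/asboolP.
Qed.

End ChiExists.

Section Girth.
Variables (R : realType) (G : sgraph).
Local Open Scope classical_set_scope.
Local Open Scope ereal_scope.

(* An acyclic graph has girth +oo. *)
Definition girth : \bar R :=
  ereal_inf [set ((size c)%:R)%:E | c in [set c : seq G | is_cycle c]].

Lemma girth_geP (m : nat) :
  (m%:R)%:E <= girth <-> forall c : seq G, is_cycle c -> (m <= size c)%N.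
Proof.
split=> [le_mg c cc|ge_m].
  rewrite -(ler_nat R) -lee_fin; apply: (le_trans le_mg).
  by apply: ereal_inf_lbound; exists c.
by apply: le_ereal_inf_tmp => _ [c cc <-]; rewrite lee_fin ler_nat ge_m.
Qed.

End Girth.

Section Outerplanar.
Variable R : realType.
Local Open Scope classical_set_scope.
Local Open Scope ring_scope.

(* A is a simple (Jordan) arc with endpoints x and y. *)
Definition is_arc (A : set (R * R)) (x y : R * R) : Prop :=
  exists f : R -> R * R,
    [/\ {within `[0, 1], continuous f}, set_inj `[0, 1] f,
        f 0 = x, f 1 = y & f @` `[0, 1] = A].

Variable G : sgraph.

(* The vertex v is drawn as the point pt v, the edge e as the arc ar e. *)
Definition planar_drawing (pt : G -> R * R) (ar : {set G} -> set (R * R)) : Prop :=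
  [/\ injective pt,
      forall u v : G, adj u v -> is_arc (ar [set u; v]%SET) (pt u) (pt v),
      forall (e : {set G}) (w : G), e \in edges G -> ar e (pt w) -> w \in e &
      forall e f : {set G}, e \in edges G -> f \in edges G -> e != f ->
        forall p, ar e p -> ar f p -> exists2 w : G, w \in e :&: f & p = pt w].

Definition drawing_support (pt : G -> R * R) (ar : {set G} -> set (R * R)) :
    set (R * R) :=
  [set p | (exists v, p = pt v) \/ (exists2 e, e \in edges G & ar e p)].

(* The faces are the connected components of the complement of the drawing;
   the outer face is the unbounded one. *)
Definition outer_face (pt : G -> R * R) (ar : {set G} -> set (R * R))
    (F : set (R * R)) : Prop :=
  (exists2 x, ~ drawing_support pt ar x
            & F = connected_component (~` drawing_support pt ar) x)
  /\ ~ bounded_set F.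

Definition outerplanar : Prop :=
  exists (pt : G -> R * R) (ar : {set G} -> set (R * R)),
    planar_drawing pt ar /\
    exists2 F, outer_face pt ar F & forall v : G, closure F (pt v).

End Outerplanar.

(* Main.v *)
Require Import Defs.
From Stdlib Require Import Btauto.
From mathcomp Require Import all_boot.
From mathcomp Require Import boolp.
From mathcomp Require Import zify.

Set Implicit Arguments.
Unset Strict Implicit.
Unset Printing Implicit Defensive.

(* With s = 1 a colouring is a pair (c, f) of vertex colourings, f v being the
   common colour of I_2(v): it is proper iff c is proper on G, f is proper on
   the square of G, and c u differs from f on the closed neighbourhood of u.

   Topology.  If two vertices a, b of an outerplanar graph were joined by three
   independent paths through middle vertices p_1, p_2, p_3, then a, b and a
   point z of the outer face would form with the p_j a K_{3,3} whose independent
   edges are disjoint.  Sampling its edges finely turns van Kampen's parity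
   obstruction into an identity over F_2 between coordinate comparisons, so no
   Jordan curve theorem is needed.

   Structure.  A triangle-free graph without such theta configurations and
   with minimum degree 2 has an end block with a Hamiltonian cycle and pairwise
   noncrossing chords.  An innermost chord closes a path of m degree-2 vertices;
   either m >= 4, or m is 2 or 3, and choosing it below a minimal chord that is
   not innermost makes one of its ends have degree at most 4.

   Colouring.  Induct on induced subgraphs: remove a vertex of degree at most 1,
   or two inner vertices of a path with m >= 4 (6 colours suffice), or all of a
   path with m = 2, 3 (7 colours suffice, thanks to the end of low degree). *)

(** * Parity of crossings *)

Section Parity.
Variable T : eqType.
Variables a b : rel T.

(* The step p -> q is drawn as a horizontal segment followed by a vertical one;
   a and b compare abscissas and ordinates, and step_crossing tells whether the
   horizontal part of p -> q meets the vertical part of r -> s. *)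
Definition opposed (p r : T) : bool :=
  (a r p == negb (a p r)) && (b r p == negb (b p r)).

Definition step_crossing (p q r s : T) : bool :=
  andb (xorb (a p s) (a q s)) (xorb (b r p) (b s p)).

Fixpoint sum_steps (F : T -> T -> bool) (p : T) (e : seq T) : bool :=
  if e is q :: e' then xorb (F p q) (sum_steps F q e') else false.

Definition crossing (p : T) (e : seq T) (r : T) (f : seq T) : bool :=
  sum_steps (fun p q => sum_steps (step_crossing p q) r f) p e.

(** Parity of the vertical parts of [f] met by the horizontal ray from [p] towards larger abscissas;
    [coray] uses the opposite ray, whence the negated comparison in [coray_step]. *)
Definition ray (r : T) (f : seq T) (p : T) : bool :=
  sum_steps (fun r s => andb (a p s) (xorb (b r p) (b s p))) r f.

Definition coray_step (r p q : T) : bool :=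
  andb (negb (a r q)) (xorb (b r p) (b r q)).

Definition coray (p : T) (e : seq T) (r : T) : bool :=
  sum_steps (coray_step r) p e.

Lemma sum_stepsD F F' p e :
  sum_steps (fun p q => xorb (F p q) (F' p q)) p e =
  xorb (sum_steps F p e) (sum_steps F' p e).
Proof. by elim: e p => [|q e IH] p //=; rewrite IH; btauto. Qed.

(** For a single step of [f] this is a Boolean identity. Along [f] the [coray_step] terms at
    intermediate points occur twice and cancel, while the ray terms add up. *)
Lemma step_crossing_path p q r f :
  all (fun x => opposed p x && opposed q x) (r :: f) ->
  xorb (sum_steps (step_crossing p q) r f)
       (sum_steps (fun r s => step_crossing r s p q) r f) =
  xorb (xorb (ray r f p) (ray r f q))
       (xorb (coray_step r p q) (coray_step (last r f) p q)).
Proof.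
elim: f r => [|s f IH] r; first by rewrite /= => _; btauto.
rewrite /= => /andP[/andP[/andP[/eqP apr /eqP bpr] /andP[/eqP aqr /eqP bqr]] H].
have /= {IH} := IH s H; move: H => /= /andP[/andP[/andP[/eqP aps /eqP bps]]].
move=> /andP[/eqP aqs /eqP bqs] _.
rewrite /ray /= -/(ray s f p) -/(ray s f q).
set X := sum_steps _ _ _; set Y := sum_steps _ _ _ => IH.
transitivity (xorb (xorb (step_crossing p q r s) (step_crossing r s p q)) (xorb X Y)).
  by btauto.
rewrite IH /step_crossing /coray_step ?(apr, bpr, aqr, bqr, aps, bps, aqs, bqs); btauto.
Qed.

(** The left side is the parity of all meetings of a horizontal part of one chain with a vertical
    part of the other. Summing [step_crossing_path] along [e] cancels the rays from its inner
    points, so only terms at the four ends survive. *)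
Lemma crossing_sym p e r f : allrel opposed (p :: e) (r :: f) ->
  xorb (crossing p e r f) (crossing r f p e) =
  xorb (xorb (ray r f p) (ray r f (last p e)))
       (xorb (coray p e r) (coray p e (last r f))).
Proof.
elim: e p => [|q e IH] p; rewrite !allrel_consl.
  rewrite /crossing /coray /= => _; set X := sum_steps _ _ _.
  have -> : X = false by rewrite /X; elim: f r @X => //= s f ->.
  btauto.
move=> /and3P[Hp Hq He]; have := IH q; rewrite allrel_consl Hq He => /(_ isT).
have := @step_crossing_path p q r f; rewrite all_predI Hp Hq => /(_ isT).
rewrite /coray /crossing /= !sum_stepsD => E1 E2.
set u := sum_steps _ _ _ in E1 *; set v := sum_steps _ _ _ in E1 *.
move: E1 E2.
set w := sum_steps _ _ _; set x := sum_steps _ _ _.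
set y := sum_steps _ _ _; set z := sum_steps _ _ _ => E1 E2.
transitivity (xorb (xorb u v) (xorb w x)); first by btauto.
by rewrite E1 E2; btauto.
Qed.

(** The two opposite rays make up the horizontal line through [p], and a chain meets this line an
    odd number of times exactly when its ends lie on different sides. *)
Lemma ray_coray r f p : all (opposed p) (r :: f) ->
  xorb (ray r f p) (coray r f p) = xorb (b p r) (b p (last r f)).
Proof.
elim: f r => [|s f IH] r; first by rewrite /ray /coray /= => _; btauto.
rewrite /=.
move=> /andP[/andP[/eqP _ /eqP bpr] H].
have {IH} := IH s H; move: H => /andP[/andP[/eqP _ /eqP bps] _].
rewrite /ray /coray /= -/(ray s f p) -/(coray s f p) /coray_step => IH.
transitivity (xorb (xorb (b p r) (b p s)) (xorb (ray s f p) (coray s f p))).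
  by rewrite bpr bps; btauto.
by rewrite IH; btauto.
Qed.

(* Summed over the 18 pairs of independent edges, crossing_sym and ray_coray leave
   only the terms b (P j) (P l) with j != l, and these add up to 3. *)
Theorem k33_crossing (A P : 'I_3 -> T) (E : 'I_3 -> 'I_3 -> seq T) :
  (forall i j, last (A i) (E i j) = P j) ->
  (forall i j k l, i != k -> j != l ->
     allrel opposed (A i :: E i j) (A k :: E k l)) ->
  (forall i j k l, i != k -> j != l ->
     crossing (A i) (E i j) (A k) (E k l) = false) -> False.
Proof.
move=> lE opp cr0.
pose W i j := ray (A i) (E i j); pose C i j := coray (A i) (E i j).
have D i j k l : i != k -> j != l ->
    xorb (xorb (W k l (A i)) (W k l (P j))) (xorb (C i j (A k)) (C i j (P l))) = false.
  move=> ik jl; rewrite -(lE i j) -(lE k l) -crossing_sym ?opp //.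
  by rewrite !cr0 // eq_sym.
have memP i j : P j \in A i :: E i j by rewrite -(lE i j) mem_last.
have oppP i j l : j != l -> all (opposed (P j)) (A i :: E i l).
  (* [opp] speaks of chains with different sources, so [P j] is taken as the end of a chain from
     some other [A k]. *)
  move=> jl; have [k ki] : exists k : 'I_3, k != i.
    by case: i => -[|m] Hm; [exists ord_max | exists ord0].
  apply/allP => x xf; exact: (allrelP (opp k j i l ki jl)) (memP k j) xf.
pose o0 := @Ordinal 3 0 isT; pose o1 := @Ordinal 3 1 isT.
pose o2 := @Ordinal 3 2 isT.
(* Over the pairs [i < k], the terms [W k l (P j)] have [k = 1] once and [k = 2] twice, the terms
   [C i j (P l)] have [i = 0] twice and [i = 1] once; those at a point [A _] occur twice each.
   Modulo 2 only the chains from [A o1] remain, and there rays and corays pair up. *)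
have WC j l : j != l -> xorb (W o1 l (P j)) (C o1 l (P j)) =
     xorb (b (P j) (A o1)) (b (P j) (P l)).
  by move=> jl; rewrite ray_coray ?lE ?oppP.
have bP j l : j != l -> b (P l) (P j) = negb (b (P j) (P l)).
  by move=> jl; have /allP/(_ _ (memP o0 l))/andP[_ /eqP] := oppP o0 j l jl.
pose S (X : 'I_3 -> 'I_3 -> bool) := xorb (xorb (xorb (X o0 o1) (X o0 o2))
  (xorb (X o1 o0) (X o1 o2))) (xorb (X o2 o0) (X o2 o1)).
have S0 i k : i != k -> S (fun j l =>
    xorb (xorb (W k l (A i)) (W k l (P j))) (xorb (C i j (A k)) (C i j (P l)))) = false.
  by move=> ik; rewrite /S !D.
have := WC o0 o1 isT; have := WC o0 o2 isT; have := WC o1 o0 isT.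
have := WC o1 o2 isT; have := WC o2 o0 isT; have := WC o2 o1 isT.
have := S0 o0 o1 isT; have := S0 o0 o2 isT; have := S0 o1 o2 isT.
rewrite /S (bP o0 o1) // (bP o0 o2) // (bP o1 o2) // => e1 e2 e3 w1 w2 w3 w4 w5 w6.
set X1 := xorb _ _ in e1; set X2 := xorb _ _ in e2; set X3 := xorb _ _ in e3.
have : xorb X1 (xorb X2 X3) = false by rewrite e1 e2 e3.
move=> {e1 e2 e3}.
suff -> : xorb X1 (xorb X2 X3) = true by [].
transitivity (
  xorb (xorb (xorb (W o1 o1 (P o0)) (C o1 o1 (P o0))) (xorb (W o1 o2 (P o0)) (C o1 o2 (P o0))))
 (xorb (xorb (xorb (W o1 o0 (P o1)) (C o1 o0 (P o1))) (xorb (W o1 o2 (P o1)) (C o1 o2 (P o1))))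
       (xorb (xorb (W o1 o0 (P o2)) (C o1 o0 (P o2))) (xorb (W o1 o1 (P o2)) (C o1 o1 (P o2)))))).
  by rewrite /X1 /X2 /X3 /=; btauto.
by rewrite w1 w2 w3 w4 w5 w6; btauto.
Qed.
End Parity.

(** * Theta-free graphs *)

Section Linked.
Variable G : sgraph.
Implicit Types (X : pred G) (u v w : G).

Lemma adj_neq (u v : G) : adj u v -> u != v.
Proof. by apply: contraTneq => ->; rewrite adj_irrefl. Qed.

Lemma edge_edges (u v : G) : adj u v -> [set u; v]%SET \in edges G.
Proof. by move=> uv; apply/imsetP; exists (u, v) => //; rewrite inE. Qed.

Definition linked X u v :=
  exists p, [/\ path (@adj G) u p, last u p = v & all X (u :: p)].

(** Disjointness is asked only for edges of the future $K_{3,3}$ that share no end: walks from the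
    same end, or to the same [p i], may meet. The third vertex joined to every [p i] will be a point
    of the outer face. *)
Definition theta_free :=
  forall (a b : G) (p : 'I_3 -> G) (A B : 'I_3 -> pred G),
    (forall i, linked (A i) a (p i)) -> (forall i, linked (B i) b (p i)) ->
    (forall i j x, i != j -> A i x -> B j x -> False) -> False.

Lemma linked_mem X u v : linked X u v -> X v.
Proof. by move=> [p [_ <- /allP]]; apply; exact: mem_last. Qed.

Lemma linked_refl X u : X u -> linked X u u.
Proof. by move=> Xu; exists [::]; rewrite /= Xu. Qed.

Lemma linked_step X u v : X u -> X v -> adj u v -> linked X u v.
Proof. by move=> Xu Xv uv; exists [:: v]; rewrite /= Xu Xv uv. Qed.

Lemma linked_trans X u v w : linked X u v -> linked X v w -> linked X u w.
Proof.
move=> [p [pp lp ap]] [r [pr lr ar]]; exists (p ++ r).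
rewrite cat_path last_cat lp pp pr lr -cat_cons all_cat ap; split=> //.
by case/andP: ar.
Qed.

Lemma linked_sym X u v : linked X u v -> linked X v u.
Proof.
move=> [p [pp <-]] {v}; elim: p u pp => [|w p IH] u /=.
  by move=> _ /andP[Xu _]; exact: linked_refl.
move=> /andP[uw wp] /andP[Xu ap]; apply: linked_trans (IH w wp ap) _.
by apply: linked_step => //; [case/andP: ap|rewrite adj_sym].
Qed.

Hypothesis theta : theta_free.

Lemma theta3 a b p0 p1 p2 A0 A1 A2 B0 B1 B2 :
  linked A0 a p0 -> linked A1 a p1 -> linked A2 a p2 ->
  linked B0 b p0 -> linked B1 b p1 -> linked B2 b p2 ->
  (forall x : G, A0 x -> B1 x || B2 x -> False) ->
  (forall x, A1 x -> B0 x || B2 x -> False) ->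
  (forall x, A2 x -> B0 x || B1 x -> False) -> False.
Proof.
move=> a0 a1 a2 b0 b1 b2 d0 d1 d2.
pose pick3 (T : Type) (x y z : T) (i : 'I_3) := match val i with 0 => x | 1 => y | _ => z end.
apply: (theta (a := a) (b := b) (p := pick3 _ p0 p1 p2) (A := pick3 _ A0 A1 A2)
  (B := pick3 _ B0 B1 B2)).
- by case=> -[|[|[|//]]] Hi; rewrite /pick3.
- by case=> -[|[|[|//]]] Hi; rewrite /pick3.
case=> -[|[|[|//]]] Hi [[|[|[|//]]] Hj] x //= _; rewrite /pick3 /= => ax bx.
- by apply: (d0 x); rewrite // bx.
- by apply: (d0 x); rewrite // bx orbT.
- by apply: (d1 x); rewrite // bx.
- by apply: (d1 x); rewrite // bx orbT.
- by apply: (d2 x); rewrite // bx.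
- by apply: (d2 x); rewrite // bx orbT.
Qed.

(** * Ears and chords of a path *)

Section Indexed.
Variables (x0 : G) (c : seq G).
Hypotheses (c_uniq : uniq c) (c_path : sorted (@adj G) c).
Local Notation v := (nth x0 c).

(** Regions of a theta are described by indices on [c], so that their disjointness becomes
    arithmetic; [Q] lists the vertices of a region that lie off [c]. *)
Definition on_index (P : pred nat) (Q : seq G) : pred G :=
  fun w => if w \in c then P (index w c) else w \in Q.

Lemma on_index_nth (P : pred nat) Q i : i < size c -> P i -> on_index P Q (v i).
Proof. by move=> ic Pi; rewrite /on_index mem_nth // index_uniq. Qed.

Lemma adj_nthS i : i.+1 < size c -> adj (v i) (v i.+1).
Proof. by move=> ic; exact: (sortedP x0 c_path). Qed.

Lemma linked_segment (P : pred nat) Q i j : i <= j -> j < size c ->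
  (forall m, i <= m <= j -> P m) -> linked (on_index P Q) (v i) (v j).
Proof.
elim: j => [|j IH] ij jc HP.
  have -> : i = 0 by lia.
  by apply: linked_refl; apply: on_index_nth => //; apply: HP; lia.
have Pj : P j.+1 by apply: HP; lia.
have [->|ltij] := eqVneq i j.+1; first by apply: linked_refl; apply: on_index_nth.
apply: linked_trans (_ : linked _ _ (v j)) _.
  by apply: IH => [||m Hm]; [lia|lia|apply: HP; lia].
by apply: linked_step (adj_nthS jc); apply: on_index_nth => //; [lia|apply: HP; lia].
Qed.

Lemma linked_chord (P : pred nat) Q i j : i < size c -> j < size c -> P i -> P j ->
  adj (v i) (v j) -> linked (on_index P Q) (v i) (v j).
Proof. by move=> ic jc Pi Pj; apply: linked_step; apply: on_index_nth. Qed.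

Lemma linked_ear (P : pred nat) Q i j : i < size c -> j < size c -> P i -> P j ->
  all (fun w => w \notin c) Q -> path (@adj G) (v i) (rcons Q (v j)) ->
  linked (on_index P Q) (v i) (v j).
Proof.
move=> ic jc Pi Pj /allP nQ pQ; exists (rcons Q (v j)); split=> //.
  by rewrite last_rcons.
rewrite /= all_rcons !on_index_nth //=; apply/allP => w wQ.
by rewrite /on_index (negPf (nQ w wQ)).
Qed.

Lemma theta_index (a b p0 p1 p2 : nat) (A0 A1 A2 B0 B1 B2 : pred nat) Q :
  linked (on_index A0 [::]) (v a) (v p0) -> linked (on_index A1 [::]) (v a) (v p1) ->
  linked (on_index A2 Q) (v a) (v p2) -> linked (on_index B0 [::]) (v b) (v p0) ->
  linked (on_index B1 [::]) (v b) (v p1) -> linked (on_index B2 [::]) (v b) (v p2) ->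
  (forall m, A0 m -> B1 m || B2 m -> False) ->
  (forall m, A1 m -> B0 m || B2 m -> False) ->
  (forall m, A2 m -> B0 m || B1 m -> False) -> False.
Proof.
move=> a0 a1 a2 b0 b1 b2 d0 d1 d2; apply: (theta3 a0 a1 a2 b0 b1 b2) => x;
  by rewrite /on_index; case: ifP => // _; first [exact: d0|exact: d1|exact: d2].
Qed.

(** [v k] and [v j] are joined through [v k.+1] along the path, through [v 0] by the edge to [v j],
    and through [v m] by the ear. An empty [Q] covers the case of an edge. *)
Lemma theta_long_ear j k m Q : adj (v 0) (v j) -> 0 < k -> k.+1 < j -> j < m < size c ->
  all (fun w => w \notin c) Q -> path (@adj G) (v k) (rcons Q (v m)) -> False.
Proof.
move=> a0j k0 kj /andP[jm mc] nQ pQ.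
apply: (@theta_index k j k.+1 0 m (fun i => k <= i <= k.+1) (fun i => i <= k)
   (fun i => (i == k) || (i == m)) (fun i => k < i <= j) (fun i => (i == 0) || (i == j))
   (fun i => j <= i <= m) Q); try by move=> i; lia.
- by apply: linked_segment => [||i]; lia.
- by apply: linked_sym; apply: linked_segment => [||i]; lia.
- by apply: linked_ear; lia.
- by apply: linked_sym; apply: linked_segment => [||i]; lia.
- by apply: linked_chord; rewrite ?eqxx ?orbT // 1?adj_sym //; lia.
- by apply: linked_segment => [||i]; lia.
Qed.

(** [v lo] and [v hi] are joined through [v lo.+1], through [v 0] by way of [v j], and through the
    first vertex [w] of the ear. As [w] is off [c] it has no index, hence [theta3] in place of
    [theta_index]. *)
Lemma theta_short_ear j lo hi w Q : adj (v 0) (v j) -> 0 < lo -> lo.+1 < hi -> hi <= j ->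
  j < size c -> all (fun w => w \notin c) (w :: Q) ->
  path (@adj G) (v lo) (rcons (w :: Q) (v hi)) -> False.
Proof.
move=> a0j lo0 lohi hij jc nQ pQ.
have /= /andP[wc _] := nQ.
apply: (theta3 (a := v lo) (b := v hi) (p0 := v lo.+1) (p1 := v 0) (p2 := w)
  (A0 := on_index (fun i => lo <= i <= lo.+1) [::]) (A1 := on_index (fun i => i <= lo) [::])
  (A2 := on_index (fun i => i == lo) (w :: Q)) (B0 := on_index (fun i => lo < i <= hi) [::])
  (B1 := on_index (fun i => (i == 0) || (hi <= i <= j)) [::])
  (B2 := on_index (fun i => i == hi) (w :: Q))).
- by apply: linked_segment => [||i]; lia.
- by apply: linked_sym; apply: linked_segment => [||i]; lia.
- apply: linked_step; first by apply: on_index_nth; lia.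
    by rewrite /on_index (negPf wc) inE eqxx.
  by case/andP: pQ.
- by apply: linked_sym; apply: linked_segment => [||i]; lia.
- apply: linked_trans (_ : linked _ _ (v j)) _.
    by apply: linked_segment => [||i]; lia.
  by apply: linked_chord; rewrite ?eqxx ?orbT // 1?adj_sym //; lia.
- apply: linked_sym; exists (rcons Q (v hi)); split; first by case/andP: pQ.
    by rewrite last_rcons.
  rewrite -rcons_cons all_rcons on_index_nth //=; last by lia.
  apply/andP; split; first by rewrite /on_index (negPf wc) inE eqxx.
  apply/allP => y yQ; rewrite /on_index (negPf (allP nQ y _)) inE yQ orbT //.
- by move=> x; rewrite /on_index; case: ifP => // _; lia.
- by move=> x; rewrite /on_index; case: ifP => // _; lia.
- by move=> x; rewrite /on_index; case: ifP => // _; lia.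
Qed.

Hypothesis triangle_free : forall x y z : G, adj x y -> adj y z -> adj x z -> False.

(** Crossing chords give a subdivided $K_4$. It contains a theta as soon as the segment from [i] to
    [j] or from [j] to [k] has an inner vertex to serve as third middle vertex; otherwise [i], [j],
    [k] are consecutive and the chord from [i] to [k] closes a triangle. *)
Lemma chords_noncrossing n i j k l : size c = n.+1 -> adj (v 0) (v n) ->
  i < j -> j < k -> k < l -> l <= n -> adj (v i) (v k) -> adj (v j) (v l) -> False.
Proof.
move=> sc a0n ij jk kl ln aik ajl.
have [lt_ij|ge_ij] := ltnP i.+1 j.
  apply: (@theta_index i j i.+1 k l (fun m => i <= m <= i.+1) (fun m => (m == i) || (m == k))
   (fun m => (m <= i) || (l <= m <= n)) (fun m => i < m <= j) (fun m => j <= m <= k)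
   (fun m => (m == j) || (m == l)) [::]); try by move=> m; lia.
  - by apply: linked_segment => [||m]; lia.
  - by apply: linked_chord; lia.
  - apply: linked_trans (_ : linked _ _ (v 0)) _.
      by apply: linked_sym; apply: linked_segment => [||m]; lia.
    apply: linked_trans (_ : linked _ _ (v n)) _.
      by apply: linked_chord; lia.
    by apply: linked_sym; apply: linked_segment => [||m]; lia.
  - by apply: linked_sym; apply: linked_segment => [||m]; lia.
  - by apply: linked_segment => [||m]; lia.
  - by apply: linked_chord; lia.
have [lt_jk|ge_jk] := ltnP j.+1 k.
  apply: (@theta_index j k j.+1 l i (fun m => j <= m <= j.+1) (fun m => (m == j) || (m == l))
   (fun m => i <= m <= j) (fun m => j < m <= k) (fun m => k <= m <= l)
   (fun m => (m == k) || (m == i)) [::]); try by move=> m; lia.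
  - by apply: linked_segment => [||m]; lia.
  - by apply: linked_chord; lia.
  - by apply: linked_sym; apply: linked_segment => [||m]; lia.
  - by apply: linked_sym; apply: linked_segment => [||m]; lia.
  - by apply: linked_segment => [||m]; lia.
  - by apply: linked_chord; rewrite 1?adj_sym //; lia.
have ej : j = i.+1 by lia. have ek : k = j.+1 by lia.
apply: (@triangle_free (v i) (v j) (v k)) => //; rewrite ?ek ?ej; apply: adj_nthS; lia.
Qed.

End Indexed.
End Linked.

(** * Cutting and gluing sequences *)

Section SeqAux.
Variable T : eqType.

Lemma sorted_glue (e : rel T) x0 s1 s2 : sorted e s1 -> sorted e s2 ->
  (s1 != [::] -> s2 != [::] -> e (last x0 s1) (head x0 s2)) -> sorted e (s1 ++ s2).
Proof.
case: s1 => [|x s1] //=; case: s2 => [|y s2] /=; first by rewrite cats0.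
by move=> p1 p2 /(_ isT isT) exy; rewrite cat_path p1 /= exy.
Qed.

Lemma last_take x0 (s : seq T) i : i < size s -> last x0 (take i.+1 s) = nth x0 s i.
Proof. by move=> lt_i; rewrite (last_nth x0) size_take_min (minn_idPl lt_i) /= nth_take. Qed.

Lemma head_drop x0 (s : seq T) i : head x0 (drop i s) = nth x0 s i.
Proof. by rewrite -nth0 nth_drop addn0. Qed.

Lemma last_drop x y (s : seq T) i : i < size s -> last x (drop i s) = last y s.
Proof. by move=> lt_i; rewrite -{2}(cat_take_drop i s) last_cat (drop_nth y). Qed.

End SeqAux.

(** * Hamiltonian cycle of an end block *)

Section Hamilton.
Variable G : sgraph.
Hypothesis theta : theta_free G.
Hypothesis triangle_free : forall x y z : G, adj x y -> adj y z -> adj x z -> False.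

Definition nbhd_in (U : {set G}) (v : G) : {set G} := [set w in U | adj v w].

Lemma ear_rev (x y : G) Q : path (@adj G) x (rcons Q y) = path (@adj G) y (rcons (rev Q) x).
Proof.
have := rev_path (@adj G) x (rcons Q y).
rewrite last_rcons belast_rcons rev_cons => ->.
by apply: eq_path => a b; rewrite adj_sym.
Qed.

Variable U : {set G}.

(* p.1 is attached to the rest of U at the single vertex p.2; a minimal one is an
   end block of U without its cut vertex. *)
Definition cut (p : {set G} * G) : bool :=
  [&& p.1 != set0, p.1 \subset U, p.2 \in U, p.2 \notin p.1 &
      [forall s in p.1, forall w in U, adj s w ==> (w \in p.2 |: p.1)]].

Variables (S : {set G}) (q : G).
Hypotheses (cutS : cut (S, q)) (minS : forall p, cut p -> #|S| <= #|p.1|).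

Let S_sub : {subset S <= U}.
Proof. by case/and5P: cutS => _ /subsetP. Qed.

Let qU : q \in U. Proof. by case/and5P: cutS. Qed.
Let qS : q \notin S. Proof. by case/and5P: cutS. Qed.

Let S_closed s w : s \in S -> w \in U -> adj s w -> w \in q |: S.
Proof. by case/and5P: cutS => _ _ _ _ /forall_inP H /H/forall_inP/(_ w)/[apply]/implyP. Qed.

Let qS_sub : {subset q |: S <= U}.
Proof. by move=> x; rewrite in_setU1 => /orP[/eqP->|/S_sub]. Qed.

Definition good_path (c : seq G) : bool :=
  [&& 1 < size c, uniq c, sorted (@adj G) c, all (mem (q |: S)) c & last q c == q].

(* Longest first, then with the last neighbour of the first vertex as far as
   possible: the latter is what a rotation of the path can improve. *)
Definition best_path (c : seq G) (j : nat) : Prop :=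
  [/\ good_path c, j < size c, adj (nth q c 0) (nth q c j),
      forall c', good_path c' -> size c' <= size c &
      forall c' j', good_path c' -> size c' = size c -> j' < size c' ->
        adj (nth q c' 0) (nth q c' j') -> j' <= j].

Lemma best_path_ex : (exists2 s, s \in S & adj s q) -> exists c j, best_path c j.
Proof.
move=> [s sS sq].
pose P n := `[< exists2 c, good_path c & size c = n >].
have exP : exists n, P n.
  exists 2; apply/asboolP; exists [:: s; q] => //.
  by rewrite /good_path /= inE (adj_neq sq) sq !in_setU1 sS eqxx orbT.
have size_le c : good_path c -> size c <= #|G|.
  by case/and5P => _ /card_uniqP<- _ _ _; exact: max_card.
have [|n /asboolP[c0 gc0 <-] max_n] := @ex_maxnP P #|G| exP.
  by move=> n /asboolP[c gc <-]; exact: size_le.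
pose P' j := `[< exists c, [/\ good_path c, size c = size c0, j < size c &
  adj (nth q c 0) (nth q c j)] >].
have exP' : exists j, P' j.
  exists 1; apply/asboolP; exists c0; have /and5P[sz _ sc _ _] := gc0.
  by split=> //; exact: (sortedP q sc).
have [|j /asboolP[c [gc scc jc aj]] max_j] := @ex_maxnP P' #|G| exP'.
  by move=> j /asboolP[c [gc _ jc _]]; exact: leq_trans (ltnW jc) (size_le _ gc).
exists c, j; split=> // [c' gc'|c' j' gc' sc' jc' aj'].
  by rewrite scc; apply: max_n; apply/asboolP; exists c'.
apply: max_j; apply/asboolP; exists c'; split=> //; by rewrite ?sc' ?scc.
Qed.

Hypothesis deg2 : forall v, v \in U -> 1 < #|nbhd_in U v|.

(** Otherwise [S] is closed under adjacency in [U], and removing any [s] from it leaves a smaller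
    cut attached at [s], nonempty because [s] has neighbours. *)
Lemma cut_adj_ex : exists2 s, s \in S & adj s q.
Proof.
have [s sS] : exists s, s \in S by case/and5P: cutS => /set0Pn.
apply: contrapT => noadj.
have nq w : w \in S -> adj w q -> False by move=> wS wq; apply: noadj; exists w.
have : cut (S :\ s, s).
  apply/and5P; split; rewrite /= ?S_sub ?setD11 //.
  - have [w] : exists w, w \in nbhd_in U s.
      by apply/set0Pn; rewrite -card_gt0 ltnW // deg2 // S_sub.
    rewrite inE => /andP[wU sw]; apply/set0Pn; exists w.
    have := S_closed sS wU sw; rewrite !inE => /orP[/eqP wq|->].
      by case: (nq s sS); rewrite -wq.
    by rewrite eq_sym adj_neq.
  - by apply/subsetP => x; rewrite inE => /andP[_ /S_sub].
  - apply/forall_inP => x; rewrite inE => /andP[_ xS]; apply/forall_inP => w wU.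
    apply/implyP => xw; have := S_closed xS wU xw; rewrite !inE.
    case/orP=> [/eqP wq|->]; last by case: eqP.
    by case: (nq x xS); rewrite -wq.
move=> /minS /=; rewrite [#|S|](cardsD1 s) sS; lia.
Qed.

Section Best.
Variables (c : seq G) (j : nat).
Hypothesis best : best_path c j.
Local Notation v := (nth q c).

Let c_uniq : uniq c. Proof. by case: best => /and5P[]. Qed.
Let c_path : sorted (@adj G) c. Proof. by case: best => /and5P[]. Qed.
Let c_sub : {subset c <= q |: S}. Proof. by case: best => /and5P[_ _ _ /allP]. Qed.
Let c_last : last q c = q. Proof. by case: best => /and5P[_ _ _ _ /eqP]. Qed.
Let size_c : 1 < size c. Proof. by case: best => /and5P[]. Qed.
Let j_lt : j < size c. Proof. by case: best. Qed.
Let adj_0j : adj (v 0) (v j). Proof. by case: best. Qed.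
Let size_max c' : good_path c' -> size c' <= size c.
Proof. by case: best => _ _ _ H _; exact: H. Qed.

Let v_eq i k : i < size c -> k < size c -> (v i == v k) = (i == k).
Proof. by move=> ic kc; exact: nth_uniq. Qed.

Let v_S i : i.+1 < size c -> v i \in S.
Proof.
move=> ic; have /c_sub : v i \in c by rewrite mem_nth // ltnW.
rewrite in_setU1 => /orP[/eqP viq|//]; exfalso; move: viq.
rewrite -{2}c_last -nth_last => /eqP.
by rewrite v_eq; lia.
Qed.

(** A neighbour off [c] could be prepended to give a longer path; on [c], its index is bounded by
    the choice of [j]. *)
Lemma best_start w : w \in U -> adj (v 0) w -> w \in c /\ index w c <= j.
Proof.
move=> wU a0w; have wc : w \in c.
  apply: contraT => wc; have := size_max (c' := w :: c).
  rewrite /= ltnn => -> //; apply/and5P; split=> //=; first exact: leqW.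
  - by rewrite wc.
  - by case: (c) size_c c_path a0w => //= x s _ ->; rewrite adj_sym => ->.
  - by rewrite (S_closed (v_S size_c)) //; apply/allP.
  - by case: (c) size_c c_last => //= x s _ ->.
split=> //; case: best => gc _ _ _ H; apply: (H c) => //; first by rewrite index_mem.
by rewrite nth_index.
Qed.

(** [v 0] has a neighbour other than [v 1], and one at index 2 would close a triangle. *)
Lemma best_index_ge3 : 2 < j.
Proof.
have v0U : v 0 \in U by apply: S_sub; exact: v_S.
have [w wN w1] : exists2 w, w \in nbhd_in U (v 0) & w != v 1.
  have := deg2 v0U; rewrite (cardsD1 (v 1)) => H.
  have /set0Pn[w] : nbhd_in U (v 0) :\ v 1 != set0 by rewrite -card_gt0; lia.
  by rewrite in_setD1 => /andP[w1 wN]; exists w.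
move: wN; rewrite inE => /andP[wU a0w].
have [wc iw] := best_start wU a0w.
apply: (leq_trans _ iw); rewrite ltnNge; apply/negP => lt_iw.
have e := nth_index q wc; have := index_mem w c; rewrite wc => iwc.
case: (index w c) e lt_iw iwc => [|[|[|//]]] e _ iwc.
- by have := adj_neq a0w; rewrite e eqxx.
- by rewrite e eqxx in w1.
- apply: (@triangle_free (v 0) (v 1) w) => //; first exact: (sortedP q c_path).
  by rewrite -e; exact: (sortedP q c_path).
Qed.

Definition ear (k m : nat) (Q : seq G) : Prop :=
  [/\ uniq Q, all (fun w => w \notin c) Q, all (mem S) Q & path (@adj G) (v k) (rcons Q (v m))].

Lemma ear_reverse k m Q : ear k m Q -> ear m k (rev Q).
Proof. by case=> uQ nQ sQ pQ; split; rewrite ?rev_uniq ?all_rev // -ear_rev. Qed.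

Let c_Q_uniq k m Q : ear k m Q -> uniq (c ++ Q).
Proof.
case=> uQ /allP nQ _ _; rewrite cat_uniq c_uniq uQ andbT; apply/hasPn => x /nQ //.
Qed.

Let ear_sorted k m Q : ear k m Q -> sorted (@adj G) Q.
Proof.
case=> _ _ _; rewrite rcons_path => /andP[+ _]; exact: path_sorted.
Qed.

Let ear_first k m Q : ear k m Q -> Q != [::] -> adj (v k) (head q Q).
Proof. by case=> _ _ _; case: Q => [|x Q] //= /andP[]. Qed.

Let ear_last k m Q : ear k m Q -> adj (last (v k) Q) (v m).
Proof. by case=> _ _ _; rewrite rcons_path => /andP[]. Qed.

Let ear_sub k m Q : ear k m Q -> all (mem (q |: S)) Q.
Proof. by case=> _ _ /allP sQ _; apply/allP => x /sQ /= xS; rewrite in_setU1 xS orbT. Qed.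

Lemma no_adjacent_ear k Q : k.+1 < size c -> Q != [::] -> ear k k.+1 Q -> False.
Proof.
move=> kc Q0 E.
have sc' : size (take k.+1 c ++ Q ++ drop k.+1 c) = size c + size Q.
  by rewrite !size_cat size_drop size_takel ?(ltnW kc) // addnCA subnKC ?(ltnW kc) // addnC.
have Qs : 0 < size Q by rewrite lt0n size_eq0.
suff /size_max : good_path (take k.+1 c ++ Q ++ drop k.+1 c) by rewrite sc'; lia.
apply/and5P; split; first by rewrite sc'; lia.
- rewrite (perm_uniq (s2 := c ++ Q)) ?(c_Q_uniq E) //.
  by apply/permP => a; rewrite !count_cat -{3}(cat_take_drop k.+1 c) count_cat; lia.
- apply: (sorted_glue (x0 := q)); first exact: take_sorted.
    apply: (sorted_glue (x0 := q)); [exact: ear_sorted E|exact: drop_sorted|].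
    by move=> _ _; rewrite head_drop; have := ear_last E; case: (Q) Q0.
  move=> _ _; rewrite last_take ?(ltnW kc) //.
  by have := ear_first E Q0; case: (Q) Q0.
- rewrite !all_cat (ear_sub E) andTb -all_cat cat_take_drop; exact/allP.
- by rewrite !last_cat (last_drop _ q) // c_last.
Qed.

(** [theta_long_ear] needs a vertex strictly between [v k] and [v j]; when [j = k.+1] a rotation of
    the path contradicts its choice instead. *)
Lemma no_long_ear k m Q : 0 < k < j -> j < m < size c -> ear k m Q -> False.
Proof.
move=> /andP[k0 kj] /andP[jm mc] E.
have [lt_kj|ge_kj] := ltnP k.+1 j.
  have [_ nQ _ pQ] := E.
  by apply: (theta_long_ear theta c_uniq c_path adj_0j k0 lt_kj _ nQ pQ); rewrite jm.
have {ge_kj kj} ek : j = k.+1 by lia.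
have kc : k < size c by lia.
(* The rotated path runs back from [v m.-1] to [v j], jumps to [v 0] by the edge between them, goes
   up to [v k], and takes the ear to [v m] and the old tail. *)
pose B := drop j (take m c); pose c' := rev B ++ take j c ++ Q ++ drop m c.
have sB : size B = m - j by rewrite size_drop size_take_min (minn_idPl (ltnW mc)).
have stm : take m c = take j c ++ B.
  by rewrite -{1}(cat_take_drop j (take m c)) take_takel // ltnW.
have cE : c = take j c ++ B ++ drop m c by rewrite catA -stm cat_take_drop.
have stj : size (take j c) = j by rewrite size_take_min (minn_idPl (ltnW j_lt)).
have sc' : size c' = size c + size Q.
  by rewrite /c' !size_cat size_rev sB stj size_drop; lia.
have hB i : i < m - j -> nth q B i = v (j + i).
  by move=> im; rewrite nth_drop nth_take //; lia.
have headc' : nth q c' 0 = v m.-1.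
  rewrite nth_cat size_rev sB ifT; last by lia.
  by rewrite nth_rev ?sB ?hB; first congr v; lia.
have midc' : nth q c' (m + size Q) = v m.
  rewrite nth_cat size_rev sB ifF; last by lia.
  rewrite nth_cat stj ifF; last by lia.
  rewrite nth_cat ifF; last by lia.
  by rewrite nth_drop; congr v; lia.
have gc' : good_path c'.
  apply/and5P; split; first by rewrite sc'; lia.
  - rewrite (perm_uniq (s2 := c ++ Q)) ?(c_Q_uniq E) //.
    by apply/permP => a; rewrite [in RHS]cE /c' !count_cat count_rev; lia.
  - apply: (sorted_glue (x0 := q)).
    + rewrite rev_sorted; apply: sub_sorted (drop_sorted _ (take_sorted _ c_path)).
      by move=> x y; rewrite adj_sym.
    + apply: (sorted_glue (x0 := q)); first exact: take_sorted.
        apply: (sorted_glue (x0 := q)); [exact: ear_sorted E|exact: drop_sorted|].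
        by move=> Q0 _; rewrite head_drop; have := ear_last E; case: (Q) Q0.
      move=> _ _; rewrite ek last_take //.
      have [Q0|Q0] := eqVneq Q [::]; last by have := ear_first E Q0; case: (Q) Q0.
      by have := ear_last E; rewrite Q0 /= head_drop.
    + move=> _ _; have -> : last q (rev B) = v j.
        move: sB (hB 0); case: (B) => [|x B'] /= sB'; first by lia.
        by rewrite rev_cons last_rcons addn0 => -> //; rewrite subn_gt0.
      have -> : head q (take j c ++ Q ++ drop m c) = v 0.
        by rewrite -nth0 nth_cat stj ek /= nth_take.
      by rewrite adj_sym.
  - rewrite !all_cat all_rev (ear_sub E) /=.
    have : all (mem (q |: S)) c by exact/allP.
    by rewrite {1}cE !all_cat => /and3P[-> -> ->].
  - by rewrite !last_cat (last_drop _ q) // c_last.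
(* Maximal length forces [Q] to be empty. Then the rotated path starts at [v m.-1], whose neighbour
   [v m] has index [m], beyond [j]. *)
have := size_max gc'; rewrite sc' => le_size.
case: best => _ _ _ _ /(_ c' (m + size Q) gc'); rewrite headc' midc'.
have -> : size Q = 0 by lia.
rewrite addn0 => H; have : m <= j; last by lia.
apply: H; [lia|lia|].
have -> : m = m.-1.+1 by lia.
by apply: (sortedP q c_path); lia.
Qed.

(** An ear between consecutive vertices could be inserted in the path; any other one leaves a path
    vertex between its ends, and yields a theta. *)
Lemma no_short_ear k m Q : 0 < k -> k < m <= j -> Q != [::] -> ear k m Q -> False.
Proof.
move=> k0 /andP[km mj] Q0 E; have [em|lt_km] := eqVneq m k.+1.
  by apply: (@no_adjacent_ear k Q); rewrite -?em //; lia.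
case: Q Q0 E => // w Q _ [_ nQ _ pQ].
by apply: (theta_short_ear theta c_uniq c_path adj_0j k0 _ mj j_lt nQ pQ); lia.
Qed.

Let q_c : q \in c.
Proof. by case: (c) size_c c_last => // x r _ /= {1}<-; exact: mem_last. Qed.

Let mem_prefix w : (w \in take j c) = (w \in c) && (index w c < j).
Proof.
apply/idP/andP => [wt|[wc iw]].
  by split; [exact: mem_take wt|move: wt; rewrite in_take_leq // ltnW].
by rewrite in_take_leq // ltnW.
Qed.

(** An edge leaving the prefix elsewhere than at [v j] is an empty long ear if it ends on [c]. If it
    ends off [c], minimality of [S] extends it to an ear that returns to [c], which is impossible as
    well. *)
Lemma cut_prefix : cut ([set w in take j c], v j).
Proof.
have v_U i : i < size c -> v i \in U by move=> ic; apply/qS_sub/c_sub/mem_nth.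
apply/and5P; split=> /=.
- apply/set0Pn; exists (v 0); rewrite inE mem_prefix mem_nth ?(ltnW size_c) //.
  by rewrite index_uniq ?(ltnW size_c) //; have := best_index_ge3; lia.
- apply/subsetP => w; rewrite inE mem_prefix => /andP[wc _]; exact/qS_sub/c_sub.
- exact: v_U.
- by rewrite inE mem_prefix index_uniq // ltnn andbF.
apply/forall_inP => s; rewrite inE mem_prefix => /andP[sc kj].
apply/forall_inP => w wU; apply/implyP => sw; rewrite !inE mem_prefix.
set k := index s c in kj; have es : s = v k by rewrite nth_index.
apply: contraT; rewrite negb_or => /andP[wj wX]; exfalso.
have k0 : 0 < k.
  rewrite lt0n; apply/eqP => ek; rewrite es ek in sw.
  have [wc iw] := best_start wU sw.
  have := nth_index q wc; have [->|ne] := eqVneq (index w c) j.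
    by move=> ew; rewrite ew eqxx in wj.
  by move=> _; rewrite wc /= ltn_neqAle ne iw in wX.
have kc : k.+1 < size c by exact: leq_ltn_trans kj j_lt.
have sS : s \in S by rewrite es v_S.
have [wc|wc] := boolP (w \in c).
  have ew := nth_index q wc; have iwc : index w c < size c by rewrite index_mem.
  apply: (@no_long_ear k (index w c) [::]); rewrite ?k0 //.
    rewrite wc /= -leqNgt in wX; rewrite iwc andbT ltn_neqAle wX andbT eq_sym.
    by apply: contraNneq wj => <-; rewrite ew.
  by split=> //=; rewrite -es ew sw.
have wS : w \in S.
  have := S_closed sS wU sw; rewrite in_setU1 => /orP[/eqP ewq|//].
  by case/negP: wc; rewrite ewq q_c.
(* [Z] will be the component of [w] in [U] without [c]. It stays inside [S], because the only exit
   [q] is on [c]. *)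
pose e := [rel x y | [&& adj x y, y \in U & y \notin c] : bool].
have e_S p x : path e x p -> x \in S -> x \notin c ->
    all (fun y => (y \in S) && (y \notin c)) p.
  elim: p x => [|y p IH] x //= /andP[/and3P[xy yU yc] yp] xS xc.
  have yS : y \in S.
    have := S_closed xS yU xy; rewrite in_setU1 => /orP[/eqP ewq|//].
    by case/negP: yc; rewrite ewq q_c.
  by rewrite yS yc /= (IH y).
pose Z := [set y | connect e w y].
have ZS y : y \in Z -> (y \in S) && (y \notin c).
  rewrite inE => /connectP[p pe ->].
  have /allP H := e_S p w pe wS wc.
  by have := mem_last w p; rewrite inE => /orP[/eqP->|/H//]; rewrite wS.
(* [Z] misses [s] and so is smaller than [S]; hence it has a neighbour besides [s], which must lie
   on [c] since [Z] is a component. This gives the second end of the ear. *)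
have nZ : ~~ cut (Z, s).
  apply/negP => /minS /=; rewrite leqNgt => /negP; apply; apply: proper_card.
  rewrite properE; apply/andP; split; first by apply/subsetP => y /ZS/andP[].
  apply/subsetPn; exists s => //; apply/negP => /ZS/andP[_].
  by rewrite sc.
have [z [w' [zZ w'U zw' w's w'Z]]] : exists z w',
    [/\ z \in Z, w' \in U, adj z w', w' != s & w' \notin Z].
  move: nZ; rewrite /cut /= => nZ; apply: contrapT => no.
  case/negP: nZ; apply/and5P; split.
  - by apply/set0Pn; exists w; rewrite inE connect0.
  - by apply/subsetP => y /ZS/andP[/S_sub].
  - exact: S_sub.
  - by apply/negP => /ZS/andP[_]; rewrite sc.
  apply/forall_inP => z zZ; apply/forall_inP => w' w'U; apply/implyP => zw'.
  apply: contraT; rewrite in_setU1 negb_or => /andP[w's w'Z].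
  by case: no; exists z, w'.
have w'c : w' \in c.
  apply: contraT => w'c; case/negP: w'Z; rewrite inE; apply: connect_trans (_ : connect e z w').
    by rewrite inE in zZ.
  by apply: connect1; rewrite /= zw' w'U w'c.
set m := index w' c; have ew' : w' = v m by rewrite nth_index.
have mc : m < size c by rewrite index_mem.
have [zS zc] := andP (ZS z zZ).
(* By [best_start] every neighbour of [v 0] is on [c], so no ear with inner vertices ends at
   [v 0]. *)
have m0 : 0 < m.
  rewrite lt0n; apply/eqP => em; rewrite ew' em adj_sym in zw'.
  by have [zc' _] := best_start (S_sub zS) zw'; rewrite zc' in zc.
have mk : m != k by apply: contraNneq w's => emk; rewrite ew' emk -es.
have [Q Q0 E] : exists2 Q, Q != [::] & ear k m Q.
  move: zZ; rewrite inE => /connectP[p pe ez].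
  case/shortenP: pe ez => p' pe' up' _ ez; exists (w :: p') => //.
  have H := e_S p' w pe' wS wc.
  split=> //.
  - by rewrite /= wc; apply: sub_all H => y /andP[].
  - by rewrite /= wS; apply: sub_all H => y /andP[].
  rewrite /= -es sw /= rcons_path -ez -ew' zw' andbT.
  by apply: sub_path pe' => x y /and3P[].
have [lt_jm|le_mj] := ltnP j m.
  by apply: no_long_ear E; rewrite ?k0 ?lt_jm.
have [lt_km|lt_mk|ekm] := ltngtP k m.
- by apply: no_short_ear Q0 E; rewrite ?lt_km.
- apply: (@no_short_ear m k (rev Q)) => //; first by rewrite lt_mk ltnW.
    by rewrite -size_eq0 size_rev size_eq0.
  exact: ear_reverse.
- by rewrite ekm eqxx in mk.
Qed.

(** Minimality identifies [S] with the prefix, so the edge from [v 0] to [v j] closes [c] into a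
    Hamiltonian cycle of [q |: S]. *)
Lemma best_spans : size c = j.+1 /\ S =i take j c.
Proof.
have TS : [set w in take j c] \subset S.
  apply/subsetP => w; rewrite inE mem_prefix => /andP[wc iw].
  by rewrite -(nth_index q wc) v_S //; lia.
have cardT : #|[set w in take j c]| = j.
  by rewrite cardsE (card_uniqP _) ?take_uniq // size_takel // ltnW.
have ST : [set w in take j c] = S.
  by apply/eqP; rewrite eqEcard TS (minS cut_prefix).
split; last by move=> w; rewrite -ST inE.
have : size c <= #|q |: S|.
  by rewrite -(card_uniqP c_uniq); apply/subset_leq_card/subsetP.
by rewrite cardsU1 qS -ST cardT; lia.
Qed.

End Best.
End Hamilton.

Lemma hamiltonian_end_block (G : sgraph) (U : {set G}) : theta_free G ->
  (forall x y z : G, adj x y -> adj y z -> adj x z -> False) ->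
  U != set0 -> (forall v, v \in U -> 1 < #|nbhd_in U v|) ->
  exists (q : G) (c : seq G) (n : nat), [/\ uniq c, sorted (@adj G) c, {subset c <= U},
    [/\ size c = n.+1, 2 < n & adj (nth q c 0) (nth q c n)] &
    forall i w, i < n -> w \in U -> adj (nth q c i) w -> w \in c].
Proof.
move=> theta tri /set0Pn[q0 q0U] deg2.
(* All of [U] but one vertex is always a cut, so a minimal cut exists even when [U] has no cut
   vertex. *)
have cut0 : cut U (U :\ q0, q0).
  apply/and5P; split; rewrite /= ?setD11 //.
  - have [w] : exists w, w \in nbhd_in U q0.
      by apply/set0Pn; rewrite -card_gt0 ltnW // deg2.
    rewrite inE => /andP[wU sw]; apply/set0Pn; exists w.
    by rewrite !inE wU eq_sym adj_neq.
  - exact: subD1set.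
  - by apply/forall_inP => x _; apply/forall_inP => w wU; apply/implyP => _; rewrite setD1K.
have [[S q] cutS minS] := arg_minnP (fun p : {set G} * G => #|p.1|) cut0.
have {}minS p : cut U p -> #|S| <= #|p.1| by exact: minS.
have [c [j best]] := best_path_ex (cut_adj_ex cutS minS deg2).
have [szc ST] := best_spans theta tri cutS minS deg2 best.
have j3 := best_index_ge3 tri cutS deg2 best.
have [/and5P[_ cu cp /allP cs /eqP cl] _ a0j _ _] := best.
have /and5P[_ /subsetP SU qU _ _] := cutS.
exists q, c, j; split=> //.
  by move=> x /cs; rewrite /= in_setU1 => /orP[/eqP->|/SU].
move=> i w ij wU aiw.
have iS : nth q c i \in S by rewrite ST; rewrite -(nth_take q ij) mem_nth // size_takel // szc.
have /and5P[_ _ _ _ /forall_inP/(_ _ iS)/forall_inP/(_ _ wU)/implyP/(_ aiw)] := cutS.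
rewrite in_setU1 => /orP[/eqP->|]; last by rewrite /= ST => /mem_take.
by case: (c) szc cl => // x r _ /= {1}<-; exact: mem_last.
Qed.

(** * Ears under innermost chords *)

Section Ears.
Variables (G : sgraph) (U : {set G}).

Definition ear_in (x : G) (s : seq G) (y : G) : Prop :=
  [/\ uniq (x :: s), uniq (rcons s y), {subset x :: rcons s y <= U} &
      forall i, i < size s ->
        nbhd_in U (nth x s i) = [set nth x (x :: rcons s y) i; nth x (x :: rcons s y) i.+2]].

(** The edge from [x] to [y] closes a cycle of length [m + 2]. The degree bound at [x] is what makes
    seven colours enough in [extend_closed_ear2] and [extend_closed_ear3]. *)
Definition closed_ear (m : nat) : Prop :=
  exists x s y, [/\ size s = m, ear_in x s y, x != y, adj x y & #|nbhd_in U x| <= 4].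

Definition long_ear : Prop := exists x s y, size s = 4 /\ ear_in x s y.

Hypothesis theta : theta_free G.
Hypothesis triangle_free : forall x y z : G, adj x y -> adj y z -> adj x z -> False.
Variables (q : G) (c : seq G) (n : nat).
Hypotheses (c_uniq : uniq c) (c_path : sorted (@adj G) c) (c_sub : {subset c <= U}).
Hypotheses (size_c : size c = n.+1) (n_gt2 : 2 < n).
Local Notation v := (nth q c).
Hypothesis adj_0n : adj (v 0) (v n).
Hypothesis c_closed : forall i w, i < n -> w \in U -> adj (v i) w -> w \in c.

Let noncross i j k l : i < j -> j < k -> k < l -> l <= n ->
  adj (v i) (v k) -> adj (v j) (v l) -> False.
Proof. exact: (chords_noncrossing theta c_uniq c_path triangle_free size_c adj_0n). Qed.

Let v_eq i k : i <= n -> k <= n -> (v i == v k) = (i == k).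
Proof. by move=> ic kc; apply: nth_uniq; rewrite ?size_c. Qed.

Let adjS i : i < n -> adj (v i) (v i.+1).
Proof. by move=> lt_in; apply: adj_nthS; rewrite ?size_c. Qed.

Let v_U i : i <= n -> v i \in U.
Proof. by move=> le_in; apply/c_sub/mem_nth; rewrite size_c. Qed.

Let nbr_index k w : k < n -> w \in U -> adj (v k) w -> exists2 t, t <= n & w = v t.
Proof.
move=> kn wU kw; have wc := c_closed kn wU kw.
by exists (index w c); rewrite ?nth_index // -ltnS -size_c index_mem.
Qed.

Let nbr_inside i j k t : adj (v i) (v j) -> i < k < j -> j <= n -> t <= n ->
  adj (v k) (v t) -> i <= t <= j.
Proof.
move=> aij /andP[ik kj] jn tn akt.
case: (leqP i t) => [_|ti] /=.
  case: (leqP t j) => // jt; exfalso; exact: (noncross ik kj jt tn aij akt).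
by rewrite adj_sym in akt; exfalso; exact: (noncross ti ik kj jn akt aij).
Qed.

(** The closing edge from [v 0] to [v n] counts as a chord, so there is always one. *)
Definition chord i j := [&& i.+1 < j, j <= n & adj (v i) (v j)].

Definition leaf i j :=
  chord i j /\ forall k l, chord k l -> i <= k -> l <= j -> k = i /\ l = j.

(** By noncrossing the neighbours of [v k] have indices between [i] and [j], and one that is not
    consecutive to [k] would give a nested chord. *)
Lemma leaf_nbhd i j k : leaf i j -> i < k < j ->
  nbhd_in U (v k) = [set v k.-1; v k.+1].
Proof.
move=> [/and3P[ij jn aij] lf] ikj; have /andP[ik kj] := ikj.
apply/setP => w; rewrite !inE; apply/idP/idP.
  move=> /andP[wU akw]; have [|||t tn ew] := @nbr_index k w => //; first by lia.
  rewrite ew in akw *; have /andP[it tj] := nbr_inside aij ikj jn tn akw.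
  rewrite !v_eq; [|lia..].
  have := adj_neq akw; rewrite v_eq; [move=> kt|lia..].
  have [ltk|gtk] := ltnP t k.
    have [//|nk] := eqVneq t k.-1; exfalso.
    have /lf/(_ it)[|_ ej] : chord t k; [|lia|lia].
    by rewrite /chord adj_sym akw; lia.
  have [->|nk] := eqVneq t k.+1; first by rewrite orbT.
  exfalso; have /lf[||ek _] : chord k t; [|lia|lia|lia].
  by rewrite /chord akw; lia.
move=> /orP[]/eqP->; rewrite v_U ?adjS //; try lia.
have {1}-> : k = k.-1.+1 by lia.
by rewrite adj_sym adjS //; lia.
Qed.

Lemma leaf_ear i j a m : leaf i j -> i <= a -> a + m.+1 <= j ->
  ear_in (v a) [seq v k | k <- iota a.+1 m] (v (a + m.+1)).
Proof.
move=> lf ia aj; have [/and3P[ij jn aij] _] := lf.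
have E : v a :: rcons [seq v k | k <- iota a.+1 m] (v (a + m.+1)) =
    [seq v k | k <- iota a m.+2].
  by rewrite -[m.+2]addn1 iotaD map_cat cats1.
have sE : size [seq v k | k <- iota a m.+2] = m.+2 by rewrite size_map size_iota.
have u : uniq [seq v k | k <- iota a m.+2].
  rewrite map_inj_in_uniq ?iota_uniq // => k l; rewrite !mem_iota => Hk Hl /eqP.
  by rewrite v_eq => [/eqP||]; lia.
have nE t : t < m.+2 -> nth (v a) [seq v k | k <- iota a m.+2] t = v (a + t).
  by move=> tm; rewrite (nth_map 0) ?size_iota // nth_iota.
split.
- by move: u; rewrite -E -rcons_cons rcons_uniq => /andP[].
- by move: u; rewrite -E /= => /andP[].
- rewrite E => _ /mapP[k + ->]; rewrite mem_iota => Hk; apply: v_U; lia.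
move=> t; rewrite size_map size_iota => tm; rewrite E !nE; [|lia..].
rewrite (nth_map 0) ?size_iota // nth_iota // (leaf_nbhd lf); last by lia.
by congr [set v _; v _]; lia.
Qed.

Lemma ear_in_rev x s y : ear_in x s y -> ear_in y (rev s) x.
Proof.
move=> [u1 u2 sU H].
have R : y :: rcons (rev s) x = rev (x :: rcons s y).
  by rewrite rev_cons rev_rcons.
split.
- by rewrite -rev_rcons rev_uniq.
- by rewrite -rev_cons rev_uniq.
- by move=> z; rewrite R mem_rev; exact: sU.
move=> i; rewrite size_rev => lt_i; rewrite R.
rewrite !(set_nth_default x y) ?size_rev ?size_rcons //=; try by rewrite ?size_rcons; lia.
rewrite !nth_rev /= ?size_rcons; try lia.
rewrite H; last by lia.
by rewrite setUC; congr [set nth _ _ _; nth _ _ _]; lia.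
Qed.

(** Length 2 would be a triangle, lengths 3 and 4 give closed ears, reversed if the end of low
    degree is [v j], and from length 5 on the first five edges form a long ear. *)
Lemma leaf_config i j : leaf i j ->
  #|nbhd_in U (v i)| <= 4 \/ #|nbhd_in U (v j)| <= 4 ->
  [\/ long_ear, closed_ear 2 | closed_ear 3].
Proof.
move=> lf low; have [/and3P[ij jn aij] _] := lf.
have closed m : j = i + m.+1 -> closed_ear m.
  move=> ej; have /= := leaf_ear lf (leqnn i) (_ : i + m.+1 <= j).
  rewrite -ej => /(_ (leqnn j)) E; have ne := adj_neq aij.
  case: low => low.
    by exists (v i), [seq v k | k <- iota i.+1 m], (v j); rewrite size_map size_iota.
  exists (v j), (rev [seq v k | k <- iota i.+1 m]), (v i).
  by rewrite size_rev size_map size_iota eq_sym ne adj_sym aij; split=> //; exact: ear_in_rev.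
have [e2|n2] := eqVneq j i.+2.
  exfalso; apply: (@triangle_free (v i) (v i.+1) (v j)) => //.
    by apply: adjS; lia.
  by rewrite e2; apply: adjS; lia.
have [e3|n3] := eqVneq j (i + 3); first by constructor 2; exact: closed.
have [e4|n4] := eqVneq j (i + 4); first by constructor 3; exact: closed.
constructor 1; exists (v i), [seq v k | k <- iota i.+1 4], (v (i + 5)); split=> //.
by apply: (leaf_ear lf); lia.
Qed.

(** Two chords from [v k] to the same side would be nested, so the longer one would not be a leaf.
    Thus [v k] has at most one chord on each side besides its two neighbours on the path. *)
Lemma low_degree i j k : (forall k l, chord k l -> l - k < j - i -> leaf k l) ->
  adj (v i) (v j) -> j <= n -> i < k < j -> #|nbhd_in U (v k)| <= 4.
Proof.
move=> min_ij aij jn ikj; have /andP[ik kj] := ikj.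
(* If no chord goes to the right the condition is vacuous, and 0 is an arbitrary value; likewise for
   [l] on the left. *)
have [r Hr] : exists r, forall t, k.+1 < t <= j -> adj (v k) (v t) -> t = r.
  have [[r [rj akr]]|no] := pselect (exists r, k.+1 < r <= j /\ adj (v k) (v r)); last first.
    by exists 0 => t tj akt; case: no; exists t.
  exists r; suff W t t' : t < t' -> k.+1 < t <= j -> adj (v k) (v t) ->
      k.+1 < t' <= j -> adj (v k) (v t') -> False.
    move=> t tj akt; case: (ltngtP t r) => // tr; exfalso.
      exact: (W t r).
    exact: (W r t).
  move=> tt' tj akt t'j akt'.
  have [_ lf] : leaf k t' by apply: min_ij; rewrite ?/chord ?akt'; lia.
  by have [|||_] := lf k t; rewrite /chord ?akt; lia.
have [l Hl] : exists l, forall t, i <= t < k.-1 -> adj (v k) (v t) -> t = l.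
  have [[l [lj akl]]|no] := pselect (exists l, i <= l < k.-1 /\ adj (v k) (v l)); last first.
    by exists 0 => t tj akt; case: no; exists t.
  exists l; suff W t t' : t < t' -> i <= t < k.-1 -> adj (v k) (v t) ->
      i <= t' < k.-1 -> adj (v k) (v t') -> False.
    move=> t tj akt; case: (ltngtP t l) => // tl; exfalso.
      exact: (W t l).
    exact: (W l t).
  move=> tt' tj akt t'j akt'.
  have [_ lf] : leaf t k by apply: min_ij; rewrite ?/chord ?[adj (v t) _]adj_sym ?akt; lia.
  by have [|||] := lf t' k; rewrite /chord 1?adj_sym ?akt'; lia.
apply: (@leq_trans #|[set w in [:: v k.-1; v k.+1; v r; v l]]|); last first.
  by rewrite cardsE; exact: card_size.
apply/subset_leq_card/subsetP => w; rewrite !inE => /andP[wU akw].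
have [|||t tn ew] := @nbr_index k w => //; first by lia.
rewrite ew in akw *; have /andP[it tj] := nbr_inside aij ikj jn tn akw.
have := adj_neq akw; rewrite v_eq; [move=> kt|lia..].
have [ltk|gtk] := ltnP t k.
  have [->|nk] := eqVneq t k.-1; first by rewrite eqxx.
  by rewrite (Hl t) ?eqxx ?orbT //; lia.
have [->|nk] := eqVneq t k.+1; first by rewrite eqxx orbT.
by rewrite (Hr t) ?eqxx ?orbT //; lia.
Qed.

Lemma block_config : [\/ long_ear, closed_ear 2 | closed_ear 3].
Proof.
have chord0n : chord 0 n by rewrite /chord adj_0n; lia.
pose P m := `[< exists i j, [/\ chord i j, ~ leaf i j & j - i = m] >].
have [exP|noP] := pselect (exists m, P m); last first.
  have all_leaf i j : chord i j -> leaf i j.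
    move=> ch; apply: contrapT => nl; apply: noP; exists (j - i).
    by apply/asboolP; exists i, j.
  (* The closing edge is itself a leaf, so there is no other chord and [v 0], which has no neighbour
     in [U] off the cycle, is adjacent in [U] only to [v 1] and [v n]. *)
  have lf := all_leaf _ _ chord0n; apply: (leaf_config lf); left.
  apply: (@leq_trans #|[set w in [:: v 1; v n]]|); last first.
    by rewrite cardsE; apply: leq_trans (card_size _) _.
  apply/subset_leq_card/subsetP => w; rewrite !inE => /andP[wU akw].
  have [|||t tn ew] := @nbr_index 0 w => //; first by lia.
  rewrite ew in akw *; have := adj_neq akw; rewrite v_eq; [move=> kt|lia..].
  rewrite !v_eq; [|lia..].
  have [//|t1] := eqVneq t 1; have [_ H] := lf.
  have [|||_ ->] := H 0 t; rewrite ?eqxx // /chord ?akw; lia.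
(* A shortest chord that is not a leaf: all shorter chords are leaves, as [low_degree] requires. *)
have [m /asboolP[i [j [ch nl ijm]]] min_m] := ex_minnP exP.
have min_ij k l : chord k l -> l - k < j - i -> leaf k l.
  move=> chkl lt; apply: contrapT => nlkl.
  have : m <= l - k by apply: min_m; apply/asboolP; exists k, l.
  by lia.
have [k [l [chkl ik lj ne]]] : exists k l, [/\ chord k l, i <= k, l <= j & ~ (k = i /\ l = j)].
  apply: contrapT => no; apply: nl; split=> // k l chkl ik lj.
  by apply: contrapT => ne; apply: no; exists k, l.
have /and3P[ij jn aij] := ch; have /and3P[kl ln akl] := chkl.
have lf : leaf k l by apply: min_ij => //; lia.
apply: (leaf_config lf).
(* The nested chord differs from the outer one, so one of its ends lies strictly between [i] and
   [j]. *)
have [lt_ik|ge_ik] := ltnP i k; [left|right]; apply: (low_degree min_ij) => //; lia.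
Qed.

End Ears.

Lemma ear_exists (G : sgraph) (U : {set G}) : theta_free G ->
  (forall x y z : G, adj x y -> adj y z -> adj x z -> False) ->
  U != set0 -> (forall v, v \in U -> 1 < #|nbhd_in U v|) ->
  [\/ long_ear U, closed_ear U 2 | closed_ear U 3].
Proof.
move=> theta tri U0 deg2.
have [q [c [n [cu cp cU [sc n2 a0n] cl]]]] := hamiltonian_end_block theta tri U0 deg2.
exact: (block_config theta tri cu cp cU sc n2 a0n cl).
Qed.

(** * Colouring by induction *)

Section Coloring.
Variables (G : sgraph) (K : nat).
Implicit Types (U W : {set G}) (c f : G -> 'I_K).

(* [c v] is the colour of the vertex v and [f v] the common colour of I_2(v). *)
Definition pair_coloring U c f : Prop :=
  [/\ forall u, u \in U -> c u != f u,
      forall u v, u \in U -> v \in U -> adj u v ->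
        [/\ c u != c v, f u != f v & c u != f v] &
      forall w u v, w \in U -> u \in U -> v \in U -> adj w u -> adj w v -> u != v ->
        f u != f v].

Lemma fresh_color (s : seq 'I_K) : size s < K -> exists a, a \notin s.
Proof.
move=> lt_s; case: (pickP [predC s]) => [a Ha|none]; first by exists a.
have : #|'I_K| <= size s; last by rewrite card_ord leqNgt lt_s.
apply: leq_trans (card_size s); apply/subset_leq_card/subsetP => a _.
by have := none a; rewrite /= => /negbFE.
Qed.

(** Only constraints involving a recoloured vertex need checking. A distance-two constraint is
    tested at its middle vertex if that lies in [W], and otherwise from a recoloured end. *)
Lemma pair_coloring_extend U W c f c' f' : pair_coloring (U :\: W) c f ->
  {in U :\: W, c =1 c'} -> {in U :\: W, f =1 f'} -> W \subset U ->
  (forall w, w \in W -> [/\ c' w != f' w,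
     forall y, y \in nbhd_in U w ->
       [/\ c' w != c' y, f' w != f' y, c' w != f' y & c' y != f' w],
     forall y z, y \in nbhd_in U w -> z \in nbhd_in U w -> y != z -> f' y != f' z &
     forall x y, x \in nbhd_in U w -> x \notin W -> y \in nbhd_in U x -> y != w ->
       f' w != f' y]) ->
  pair_coloring U c' f'.
Proof.
move=> [g1 g2 g3] ec ef WU H.
have old z : z \in U -> z \notin W -> z \in U :\: W by move=> zU zW; rewrite inE zW zU.
have nb z y : y \in U -> adj z y -> y \in nbhd_in U z by move=> yU zy; rewrite inE yU zy.
split.
- move=> u uU; have [uW|uW] := boolP (u \in W); first by case: (H u uW).
  by rewrite -ec -?ef ?old // g1 // old.
- move=> u v uU vU uv; have [uW|uW] := boolP (u \in W).
    by case: (H u uW) => _ /(_ v (nb _ _ vU uv))[].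
  have [vW|vW] := boolP (v \in W).
    rewrite adj_sym in uv; case: (H v vW) => _ /(_ u (nb _ _ uU uv))[h1 h2 h3 h4] _ _.
    by rewrite eq_sym h1 eq_sym h2 h4.
  by rewrite -!ec -?ef ?old //; apply: g2; rewrite ?old.
move=> w u v wU uU vU wu wv uv; have [wW|wW] := boolP (w \in W).
  by case: (H w wW) => _ _ h _; apply: h; rewrite ?nb.
have [uW|uW] := boolP (u \in W).
  by case: (H u uW) => _ _ _ h; apply: (h w); rewrite ?nb 1?eq_sym // adj_sym.
have [vW|vW] := boolP (v \in W).
  by rewrite eq_sym; case: (H v vW) => _ _ _ h; apply: (h w); rewrite ?nb // adj_sym.
by rewrite -?ef ?old //; apply: (g3 w); rewrite ?old.
Qed.

Definition recolor (T : Type) (c : G -> T) (s : seq (G * T)) : G -> T :=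
  foldr (fun p g z => if z == p.1 then p.2 else g z) c s.

Lemma recolor_old (T : Type) (c : G -> T) s z : z \notin map fst s -> recolor c s z = c z.
Proof.
elim: s => [|[u a] s IH] //=; rewrite inE negb_or => /andP[/negPf-> /IH//].
Qed.

(** The colour is meant as [f w] for a removed neighbour [w] of [x]. It avoids [c x], [f x], the
    values of [f] at the other neighbours of [x], and [extra]; omitting [w] gives the count in the
    hypothesis. *)
Lemma fresh_at U W c f x (extra : seq 'I_K) :
  x \in U -> (exists2 w, w \in W & w \in nbhd_in U x) ->
  #|nbhd_in U x| + 1 + size extra < K ->
  exists a, [/\ a \notin extra, c x != a &
    forall y, y \in x |: nbhd_in U x -> y \notin W -> a != f y].
Proof.
move=> xU [w wW wN] lt_K.
have [|a] := @fresh_color (c x :: f x :: [seq f z | z <- enum (nbhd_in U x :\ w)] ++ extra).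
  rewrite /= size_cat size_map -cardE; move: lt_K; rewrite (cardsD1 w) wN; lia.
rewrite !inE mem_cat !negb_or => /and4P[ac af an ae].
exists a; split=> //; first by rewrite eq_sym.
move=> y; rewrite in_setU1 => /orP[/eqP->//|yN] yW; apply: contraNneq an => ->.
by apply: map_f; rewrite mem_enum !in_setD1 yN andbT; apply: contraNneq yW => ->.
Qed.

Lemma extend_pendant U c f v : 5 < K -> (forall x, x \in U -> #|nbhd_in U x| + 2 <= K) ->
  v \in U -> #|nbhd_in U v| <= 1 -> pair_coloring (U :\ v) c f ->
  exists c' f', pair_coloring U c' f'.
Proof.
move=> K6 degK vU deg1 good.
have vv : v \notin nbhd_in U v by rewrite inE adj_irrefl andbF.
(* [a] becomes [f v] and [b] becomes [c v]. *)
suff [a [b [ab H]]] : exists a b, b != a /\ forall x, x \in nbhd_in U v ->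
    [/\ nbhd_in U v = [set x], b \notin [:: c x; f x], c x != a &
       forall y, y \in x |: nbhd_in U x -> y != v -> a != f y].
  exists (recolor c [:: (v, b)]), (recolor f [:: (v, a)]).
  apply: (pair_coloring_extend good).
  - by move=> z; rewrite !inE => /andP[zv _]; rewrite recolor_old // inE.
  - by move=> z; rewrite !inE => /andP[zv _]; rewrite recolor_old // inE.
  - by rewrite sub1set.
  move=> w /set1P->; rewrite /= eqxx; split=> //.
  - move=> y yN; have [_ + ca ay] := H y yN; rewrite !inE negb_or => /andP[bc bf].
    have yv : y != v by apply: contraNneq vv => e; rewrite -{1}e.
    by rewrite (negPf yv); split=> //; apply: ay; rewrite ?setU11.
  - by move=> y z yN; have [-> _ _ _] := H y yN; move: yN => _ /set1P->; rewrite eqxx.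
  - move=> x y xN _ yN yv; have [_ _ _ ay] := H x xN.
    by rewrite (negPf yv) ay // in_setU1 yN orbT.
have [/eqP|d1] := eqVneq #|nbhd_in U v| 0.
  rewrite cards_eq0 => /eqP N0.
  have [|a _] := @fresh_color [::]; first by rewrite /=; lia.
  have [|b] := @fresh_color [:: a]; first by rewrite /=; lia.
  by rewrite inE => ba; exists a, b; split=> // x; rewrite N0 inE.
have /cards1P[x Nv] : #|nbhd_in U v| == 1 by lia.
have : x \in nbhd_in U v by rewrite Nv set11.
rewrite inE => /andP[xU vx].
have [||a [_ ca Ha]] := @fresh_at U [set v] c f x [::] xU.
- by exists v; rewrite ?set11 // inE vU adj_sym.
- by rewrite /=; have := degK x xU; lia.
have [|b] := @fresh_color [:: a; c x; f x]; first by rewrite /=; lia.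
rewrite !inE !negb_or => /and3P[ba bc bf]; exists a, b; split=> // z; rewrite Nv => /set1P->.
split=> //; first by rewrite !inE negb_or bc bf.
by move=> y yN yv; apply: Ha => //; rewrite in_set1.
Qed.
(** Only the two middle vertices are removed. Since [p1] and [p4] keep their colours, the ends enter
    only through [f x] and [f y], whatever their degrees, and each new colour has at most five
    values to avoid. *)
Lemma extend_long_ear U : 5 < K -> long_ear U ->
  (forall U', U' \proper U -> exists c f, pair_coloring U' c f) ->
  exists c f, pair_coloring U c f.
Proof.
move=> K6 [x [s [y [sz [u1 u2 sU H]]]]] IH.
case: s sz u1 u2 sU H => [|p1 [|p2 [|p3 [|p4 []]]]] //= _.
rewrite !inE !negb_or => /and5P[/and4P[xp1 xp2 xp3 xp4]].
move=> /and3P[p12 p13 p14] /andP[p23 p24] p34 _.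
move=> /and5P[/and4P[_ _ _ p1y] /and3P[_ _ p2y] /andP[_ p3y] p4y _] sU H.
have N1 : nbhd_in U p1 = [set x; p2] by exact: (H 0).
have N2 : nbhd_in U p2 = [set p1; p3] by exact: (H 1).
have N3 : nbhd_in U p3 = [set p2; p4] by exact: (H 2).
have N4 : nbhd_in U p4 = [set p3; y] by exact: (H 3).
have pU p : p \in [:: x; p1; p2; p3; p4; y] -> p \in U by exact: sU.
pose W := [set p2; p3].
have [|c [f good]] := IH (U :\: W).
  rewrite properE subsetDl; apply/subsetPn; exists p2; last by rewrite !inE eqxx.
  by rewrite pU // !inE eqxx !orbT.
have [|a2] := @fresh_color [:: f x; f p1; f p4; c p1]; first exact: leq_trans K6.
have [|a3] := @fresh_color [:: f y; f p1; f p4; c p4; a2]; first exact: leq_trans K6.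
have [|b2] := @fresh_color [:: c p1; f p1; a2; a3]; first exact: leq_trans K6.
have [|b3] := @fresh_color [:: c p4; f p4; a2; a3; b2]; first exact: leq_trans K6.
rewrite !inE !negb_or => /and5P[b3c4 b3f4 b32 b33 b3b2] /and4P[b2c1 b2f1 b2a2 b2a3].
move=> /and5P[a3y a31 a34 a3c4 a3a2] /and4P[a2x a21 a24 a2c1].
pose c' := recolor c [:: (p2, b2); (p3, b3)]; pose f' := recolor f [:: (p2, a2); (p3, a3)].
have old (T : Type) (g : G -> T) (a b : T) z : z != p2 -> z != p3 ->
    recolor g [:: (p2, a); (p3, b)] z = g z.
  by move=> z2 z3; rewrite recolor_old // !inE negb_or z2 z3.
have c2 : c' p2 = b2 by rewrite /c' /= eqxx.
have f2 : f' p2 = a2 by rewrite /f' /= eqxx.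
have c3 : c' p3 = b3 by rewrite /c' /= eqxx eq_sym (negPf p23).
have f3 : f' p3 = a3 by rewrite /f' /= eqxx eq_sym (negPf p23).
have [fx fy] : f' x = f x /\ f' y = f y by rewrite /f' !old // eq_sym.
have [c1 f1] : c' p1 = c p1 /\ f' p1 = f p1 by rewrite /c' /f' !old.
have [c4 f4] : c' p4 = c p4 /\ f' p4 = f p4 by rewrite /c' /f' !old // eq_sym.
exists c', f'; apply: (pair_coloring_extend good).
- by move=> z; rewrite !inE !negb_or => /andP[/andP[z2 z3] _]; rewrite /c' old.
- by move=> z; rewrite !inE !negb_or => /andP[/andP[z2 z3] _]; rewrite /f' old.
- by apply/subsetP => z; rewrite !inE => /orP[]/eqP->; rewrite pU // !inE eqxx !orbT.
move=> w; rewrite in_set2 => /orP[]/eqP->; split.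
- by rewrite c2 f2.
- rewrite N2 => z; rewrite in_set2 => /orP[]/eqP->; rewrite ?(c1, c2, c3, f1, f2, f3).
    by split=> //; rewrite eq_sym.
  by split=> //; rewrite eq_sym.
- rewrite N2 => z z'; rewrite !in_set2 => /orP[]/eqP-> /orP[]/eqP->; rewrite ?eqxx //
    ?(f1, f3) => _ //; by rewrite eq_sym.
- rewrite N2 => z z'; rewrite in_set2 => /orP[]/eqP->; last by rewrite !inE eqxx orbT.
  by move=> _; rewrite N1 in_set2 => /orP[]/eqP->; rewrite ?eqxx // f2 fx.
- by rewrite c3 f3.
- rewrite N3 => z; rewrite in_set2 => /orP[]/eqP->; rewrite ?(c4, c2, c3, f4, f2, f3).
    by split=> //; rewrite eq_sym.
  by split=> //; rewrite eq_sym.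
- rewrite N3 => z z'; rewrite !in_set2 => /orP[]/eqP-> /orP[]/eqP->; rewrite ?eqxx //
    ?(f2, f4) => _ //; by rewrite eq_sym.
- rewrite N3 => z z'; rewrite in_set2 => /orP[]/eqP->; first by rewrite !inE eqxx.
  by move=> _; rewrite N4 in_set2 => /orP[]/eqP->; rewrite ?eqxx // f3 fy.
Qed.

(** The value of [f] at [p2] is chosen first, because the degree of [y] may leave no slack. The
    value at [p1] must also differ from it, which costs at most 4 + 1 + 1 colours as [x] has degree
    at most 4. The edge from [x] to [y] makes [fresh_at] cover the distance-two constraints inside
    the 4-cycle. *)
Lemma extend_closed_ear2 U : 6 < K -> (forall x, x \in U -> #|nbhd_in U x| + 2 <= K) ->
  closed_ear U 2 ->
  (forall U', U' \proper U -> exists c f, pair_coloring U' c f) ->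
  exists c f, pair_coloring U c f.
Proof.
move=> K7 degK [x [s [y [sz [u1 u2 sU H] xy axy low]]]] IH.
case: s sz u1 u2 sU H => [|p1 [|p2 []]] //= _.
rewrite !inE !negb_or => /and3P[/andP[xp1 xp2] p12 _] /and3P[/andP[_ p1y] p2y _] sU H.
have N1 : nbhd_in U p1 = [set x; p2] by exact: (H 0).
have N2 : nbhd_in U p2 = [set p1; y] by exact: (H 1).
have pU p : p \in [:: x; p1; p2; y] -> p \in U by exact: sU.
have [xU [p1U [p2U yU]]] : x \in U /\ p1 \in U /\ p2 \in U /\ y \in U.
  by rewrite !pU // !inE eqxx ?orbT.
have ax1 : adj p1 x by have := set21 x p2; rewrite -N1 inE => /andP[].
have ay2 : adj p2 y by have := set22 p1 y; rewrite -N2 inE => /andP[].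
pose W := [set p1; p2].
have [|c [f good]] := IH (U :\: W).
  by rewrite properE subsetDl; apply/subsetPn; exists p1; rewrite // !inE eqxx.
have [||a2 [_ cy2 Ha2]] := @fresh_at U W c f y [::] yU.
- by exists p2; rewrite !inE ?eqxx ?orbT // p2U adj_sym.
- by move: (degK y yU); clear; rewrite /=; lia.
have [||a1 [a12 cx1 Ha1]] := @fresh_at U W c f x [:: a2] xU.
- by exists p1; rewrite !inE ?eqxx ?orbT // p1U adj_sym.
- by move: low K7; clear; rewrite /=; lia.
have [|b1] := @fresh_color [:: c x; f x; a1; a2]; first exact: leq_trans K7.
have [|b2] := @fresh_color [:: c y; f y; a1; a2; b1]; first exact: leq_trans K7.
rewrite !inE !negb_or => /and5P[b2y b2fy b21 b22 b2b1] /and4P[b1x b1fx b11 b1a2].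
rewrite !inE in a12.
pose c' := recolor c [:: (p1, b1); (p2, b2)]; pose f' := recolor f [:: (p1, a1); (p2, a2)].
have old (T : Type) (g : G -> T) (a b : T) z : z != p1 -> z != p2 ->
    recolor g [:: (p1, a); (p2, b)] z = g z.
  by move=> z2 z3; rewrite recolor_old // !inE negb_or z2 z3.
have c1 : c' p1 = b1 by rewrite /c' /= eqxx.
have f1 : f' p1 = a1 by rewrite /f' /= eqxx.
have c2 : c' p2 = b2 by rewrite /c' /= eqxx eq_sym (negPf p12).
have f2 : f' p2 = a2 by rewrite /f' /= eqxx eq_sym (negPf p12).
have [cx fx] : c' x = c x /\ f' x = f x by rewrite /c' /f' !old.
have [cy fy] : c' y = c y /\ f' y = f y by rewrite /c' /f' !old // eq_sym.
have xW : x \notin W by rewrite !inE negb_or xp1.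
have yW : y \notin W by rewrite !inE negb_or eq_sym p1y eq_sym.
have a1x := Ha1 x (setU11 _ _) xW; have a2y := Ha2 y (setU11 _ _) yW.
have a1y : a1 != f y by apply: Ha1 => //; rewrite in_setU1 inE yU axy orbT.
have a2x : a2 != f x by apply: Ha2 => //; rewrite in_setU1 inE xU adj_sym axy orbT.
exists c', f'; apply: (pair_coloring_extend good).
- by move=> z; rewrite !inE !negb_or => /andP[/andP[z2 z3] _]; rewrite /c' old.
- by move=> z; rewrite !inE !negb_or => /andP[/andP[z2 z3] _]; rewrite /f' old.
- by apply/subsetP => z; rewrite !inE => /orP[]/eqP->.
move=> w; rewrite in_set2 => /orP[]/eqP->; split.
- by rewrite c1 f1.
- rewrite N1 => z; rewrite in_set2 => /orP[]/eqP->; rewrite ?(c1, c2, cx, f1, f2, fx).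
    by split.
  by split=> //; rewrite eq_sym.
- rewrite N1 => z z'; rewrite !in_set2 => /orP[]/eqP-> /orP[]/eqP->; rewrite ?eqxx //
    ?(fx, f2) => _ //; by rewrite eq_sym.
- rewrite N1 => z z'; rewrite in_set2 => /orP[]/eqP->; last by rewrite !inE eqxx orbT.
  move=> _ z'N z'1; have [z'2|z'2] := eqVneq z' p2.
    have : x \in nbhd_in U p2 by move: z'N; rewrite z'2 !inE xU adj_sym => /andP[].
    by rewrite N2 in_set2 (negPf xp1) (negPf xy).
  rewrite f1 /f' old //; apply: Ha1; first by rewrite in_setU1 z'N orbT.
  by rewrite in_set2 negb_or z'1.
- by rewrite c2 f2.
- rewrite N2 => z; rewrite in_set2 => /orP[]/eqP->; rewrite ?(c1, c2, cy, f1, f2, fy).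
    by split=> //; rewrite eq_sym.
  by split.
- rewrite N2 => z z'; rewrite !in_set2 => /orP[]/eqP-> /orP[]/eqP->; rewrite ?eqxx //
    ?(fy, f1) => _ //; by rewrite eq_sym.
- rewrite N2 => z z'; rewrite in_set2 => /orP[]/eqP->; first by rewrite !inE eqxx.
  move=> _ z'N z'2; have [z'1|z'1] := eqVneq z' p1.
    have : y \in nbhd_in U p1 by move: z'N; rewrite z'1 !inE yU adj_sym => /andP[].
    by rewrite N1 in_set2 eq_sym (negPf xy) eq_sym (negPf p2y).
  rewrite f2 /f' old //; apply: Ha2; first by rewrite in_setU1 z'N orbT.
  by rewrite in_set2 negb_or z'1.
Qed.
(** Same order as for the 4-cycle: [p3] next to [y] first, then [p1] next to the low-degree end,
    where the extra colour now comes from distance two through [p2]. The other four choices each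
    avoid at most five colours. *)
Lemma extend_closed_ear3 U : 6 < K -> (forall x, x \in U -> #|nbhd_in U x| + 2 <= K) ->
  closed_ear U 3 ->
  (forall U', U' \proper U -> exists c f, pair_coloring U' c f) ->
  exists c f, pair_coloring U c f.
Proof.
move=> K7 degK [x [s [y [sz [u1 u2 sU H] xy axy low]]]] IH.
case: s sz u1 u2 sU H => [|p1 [|p2 [|p3 []]]] //= _.
rewrite !inE !negb_or => /and4P[/and3P[xp1 xp2 xp3] /andP[p12 p13] p23 _].
move=> /and4P[/and3P[_ _ p1y] /andP[_ p2y] p3y _] sU H.
have N1 : nbhd_in U p1 = [set x; p2] by exact: (H 0).
have N2 : nbhd_in U p2 = [set p1; p3] by exact: (H 1).
have N3 : nbhd_in U p3 = [set p2; y] by exact: (H 2).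
have pU p : p \in [:: x; p1; p2; p3; y] -> p \in U by exact: sU.
have [xU [p1U [p2U [p3U yU]]]] : x \in U /\ p1 \in U /\ p2 \in U /\ p3 \in U /\ y \in U.
  by rewrite !pU // !inE eqxx ?orbT.
have ax1 : adj p1 x by have := set21 x p2; rewrite -N1 inE => /andP[].
have ay3 : adj p3 y by have := set22 p2 y; rewrite -N3 inE => /andP[].
pose W := [set p1; p2; p3].
have inW z : (z \in W) = [|| z == p1, z == p2 | z == p3] by rewrite !inE orbA.
have [|c [f good]] := IH (U :\: W).
  by rewrite properE subsetDl; apply/subsetPn; exists p1; rewrite // in_setD inW eqxx.
have [||a3 [_ cy3 Ha3]] := @fresh_at U W c f y [::] yU.
- by exists p3; rewrite ?inW ?eqxx ?orbT // inE p3U adj_sym.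
- by move: (degK y yU); clear; rewrite /=; lia.
have [||a1 [a13 cx1 Ha1]] := @fresh_at U W c f x [:: a3] xU.
- by exists p1; rewrite ?inW ?eqxx ?orbT // inE p1U adj_sym.
- by move: low K7; clear; rewrite /=; lia.
have [|a2] := @fresh_color [:: f x; a1; a3; f y]; first exact: leq_trans K7.
have [|b1] := @fresh_color [:: c x; f x; a1; a2]; first exact: leq_trans K7.
have [|b2] := @fresh_color [:: a1; a2; a3; b1]; first exact: leq_trans K7.
have [|b3] := @fresh_color [:: c y; f y; a2; a3; b2]; first exact: leq_trans K7.
rewrite !inE !negb_or => /and5P[b3y b3fy b32 b33 b3b2] /and4P[b21 b22 b23 b2b1].
move=> /and4P[b1x b1fx b11 b12] /and4P[a2x a21 a23 a2y].
rewrite !inE in a13.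
pose c' := recolor c [:: (p1, b1); (p2, b2); (p3, b3)].
pose f' := recolor f [:: (p1, a1); (p2, a2); (p3, a3)].
have old (T : Type) (g : G -> T) (r s t : T) z : z != p1 -> z != p2 -> z != p3 ->
    recolor g [:: (p1, r); (p2, s); (p3, t)] z = g z.
  by move=> z1 z2 z3; rewrite recolor_old // !inE !negb_or z1 z2 z3.
have c1 : c' p1 = b1 by rewrite /c' /= eqxx.
have f1 : f' p1 = a1 by rewrite /f' /= eqxx.
have c2 : c' p2 = b2 by rewrite /c' /= eqxx eq_sym (negPf p12).
have f2 : f' p2 = a2 by rewrite /f' /= eqxx eq_sym (negPf p12).
have c3 : c' p3 = b3 by rewrite /c' /= eqxx eq_sym (negPf p13) eq_sym (negPf p23).
have f3 : f' p3 = a3 by rewrite /f' /= eqxx eq_sym (negPf p13) eq_sym (negPf p23).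
have [cx fx] : c' x = c x /\ f' x = f x by rewrite /c' /f' !old.
have [cy fy] : c' y = c y /\ f' y = f y by rewrite /c' /f' !old // eq_sym.
have xW : x \notin W by rewrite inW !negb_or xp1 xp2.
have yW : y \notin W by rewrite inW !negb_or !(eq_sym y) p1y p2y.
have a1x := Ha1 x (setU11 _ _) xW; have a3y := Ha3 y (setU11 _ _) yW.
exists c', f'; apply: (pair_coloring_extend good).
- by move=> z; rewrite in_setD inW !negb_or => /andP[/and3P[z1 z2 z3] _]; rewrite /c' old.
- by move=> z; rewrite in_setD inW !negb_or => /andP[/and3P[z1 z2 z3] _]; rewrite /f' old.
- by apply/subsetP => z; rewrite inW => /or3P[]/eqP->.
move=> w; rewrite inW => /or3P[]/eqP->; split.
- by rewrite c1 f1.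
- rewrite N1 => z; rewrite in_set2 => /orP[]/eqP->; rewrite ?(c1, c2, cx, f1, f2, fx).
    by split.
  by split=> //; rewrite eq_sym.
- rewrite N1 => z z'; rewrite !in_set2 => /orP[]/eqP-> /orP[]/eqP->; rewrite ?eqxx //
    ?(fx, f2) => _ //; by rewrite eq_sym.
- rewrite N1 => z z'; rewrite in_set2 => /orP[]/eqP->; last by rewrite inW eqxx orbT.
  move=> _ z'N z'1.
  have z'x : adj z' x by move: z'N; rewrite inE adj_sym => /andP[].
  have z'2 : z' != p2.
    apply/eqP => e; have : x \in nbhd_in U p2 by rewrite inE xU -e.
    by rewrite N2 in_set2 (negPf xp1) (negPf xp3).
  have z'3 : z' != p3.
    apply/eqP => e; have : x \in nbhd_in U p3 by rewrite inE xU -e.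
    by rewrite N3 in_set2 (negPf xp2) (negPf xy).
  rewrite f1 /f' old //; apply: Ha1; first by rewrite in_setU1 z'N orbT.
  by rewrite inW !negb_or z'1 z'2.
- by rewrite c2 f2.
- rewrite N2 => z; rewrite in_set2 => /orP[]/eqP->; rewrite ?(c1, c2, c3, f1, f2, f3).
    by split=> //; rewrite eq_sym.
  by split=> //; rewrite eq_sym.
- rewrite N2 => z z'; rewrite !in_set2 => /orP[]/eqP-> /orP[]/eqP->; rewrite ?eqxx //
    ?(f3, f1) => _ //; by rewrite eq_sym.
- by rewrite N2 => z z'; rewrite in_set2 => /orP[]/eqP->; rewrite inW eqxx ?orbT.
- by rewrite c3 f3.
- rewrite N3 => z; rewrite in_set2 => /orP[]/eqP->; rewrite ?(c3, c2, cy, f3, f2, fy).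
    by split=> //; rewrite eq_sym.
  by split.
- rewrite N3 => z z'; rewrite !in_set2 => /orP[]/eqP-> /orP[]/eqP->; rewrite ?eqxx //
    ?(fy, f2) => _ //; by rewrite eq_sym.
- rewrite N3 => z z'; rewrite in_set2 => /orP[]/eqP->; first by rewrite inW eqxx orbT.
  move=> _ z'N z'3.
  have z'y : adj z' y by move: z'N; rewrite inE adj_sym => /andP[].
  have z'2 : z' != p2.
    apply/eqP => e; have : y \in nbhd_in U p2 by rewrite inE yU -e.
    by rewrite N2 in_set2 !(eq_sym y) (negPf p1y) (negPf p3y).
  have z'1 : z' != p1.
    apply/eqP => e; have : y \in nbhd_in U p1 by rewrite inE yU -e.
    by rewrite N1 in_set2 !(eq_sym y) (negPf xy) (negPf p2y).
  rewrite f3 /f' old //; apply: Ha3; first by rewrite in_setU1 z'N orbT.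
  by rewrite inW !negb_or z'1 z'2.
Qed.

Lemma pair_coloring_ex : theta_free G ->
  (forall x y z : G, adj x y -> adj y z -> adj x z -> False) ->
  5 < K -> (forall U x, #|nbhd_in U x| + 2 <= K) ->
  (6 < K \/ forall U m, 1 < m < 4 -> ~ closed_ear U m) ->
  forall U, exists c f, pair_coloring U c f.
Proof.
move=> theta tri K6 degK K7 U.
have [m] := ubnP #|U|; elim: m U => // m IHm U leUm.
have IH U' : U' \proper U -> exists c f, pair_coloring U' c f.
  by move=> pU; apply: IHm; exact: leq_trans (proper_card pU) leUm.
have [->|U0] := eqVneq U set0.
  have [|a _] := @fresh_color [::]; first exact: leq_trans K6.
  by exists (fun=> a), (fun=> a); split=> [u|u v|w u v]; rewrite inE.
have [/forall_inP deg2|] := boolP [forall v in U, 1 < #|nbhd_in U v|]; last first.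
  rewrite negb_forall => /existsP[v]; rewrite negb_imply -leqNgt => /andP[vU deg1].
  have [c [f good]] := IH _ (properD1 vU).
  by apply: extend_pendant deg1 good => // x _; exact: degK.
have [le|e2|e3] := ear_exists theta tri U0 deg2.
- exact: extend_long_ear le IH.
- case: K7 => [K7|no]; last by case: (no U 2).
  by apply: extend_closed_ear2 e2 IH => // x _; exact: degK.
- case: K7 => [K7|no]; last by case: (no U 3).
  by apply: extend_closed_ear3 e3 IH => // x _; exact: degK.
Qed.
End Coloring.

(** * Incidences, and the lower bound on the number of colours *)

Section Incidences.
Variable G : sgraph.

(** For [i] in $I_2(v)$ this is $v$, so an incidence receives the colour [f (far_end i)]. *)
Definition far_end (i : incidence G) : G :=
  odflt (inc_vertex i) [pick w in inc_edge i | w != inc_vertex i].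

Lemma far_endP (i : incidence G) :
  inc_edge i = [set inc_vertex i; far_end i] /\ adj (inc_vertex i) (far_end i).
Proof.
have /andP[/imsetP[[u v] /=]] := valP i; rewrite inE /= => uv.
rewrite -/(inc_edge i) -/(inc_vertex i) => ei.
have neq_uv := adj_neq uv.
rewrite ei => ui; rewrite /far_end ei.
case: pickP => [w /andP[wi wNi] /=|none].
  move: ui wi wNi; rewrite !inE.
  case/orP=> /eqP-> /orP[] /eqP->; rewrite ?eqxx // => _; split=> //.
    by rewrite setUC.
  by rewrite adj_sym.
move: ui; rewrite !inE => /orP[] /eqP iE.
  by move: (none v); rewrite !inE iE eqxx orbT eq_sym neq_uv.
by move: (none u); rewrite !inE iE eqxx neq_uv.
Qed.

Lemma incidence_eq (i j : incidence G) :
  inc_vertex i = inc_vertex j -> far_end i = far_end j -> i = j.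
Proof.
move=> vij oij; apply/val_inj.
rewrite [LHS]surjective_pairing [RHS]surjective_pairing.
rewrite -!/(inc_vertex _) -!/(inc_edge _).
by have [-> _] := far_endP i; have [-> _] := far_endP j; rewrite vij oij.
Qed.

Lemma inc_edge_eq (i j : incidence G) : inc_edge i = inc_edge j -> i != j ->
  inc_vertex j = far_end i /\ far_end j = inc_vertex i.
Proof.
have [ei ai] := far_endP i; have [ej aj] := far_endP j; move=> eij ij.
have ni := adj_neq ai; have nj := adj_neq aj; rewrite ei ej in eij.
have : inc_vertex j \in [set inc_vertex i; far_end i] by rewrite eij set21.
have : far_end j \in [set inc_vertex i; far_end i] by rewrite eij set22.
rewrite !in_set2 => /orP[]/eqP h1 /orP[]/eqP h2.
- by rewrite h1 h2 eqxx in nj.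
- by [].
- by rewrite (incidence_eq h2 h1) eqxx in ij.
- by rewrite h1 h2 eqxx in nj.
Qed.

Lemma incidence_ex (u v : G) : adj u v ->
  exists i : incidence G, inc_vertex i = u /\ far_end i = v.
Proof.
move=> uv; have H : is_incidence (u, [set u; v]).
  by rewrite /is_incidence /= edge_edges // set21.
pose i : incidence G := exist _ (u, [set u; v]) H; exists i; split=> //.
have [ei ai] := far_endP i.
have : far_end i \in [set u; v] by rewrite -[[set u; v]]/(inc_edge i) ei set22.
by rewrite in_set2 => /orP[]/eqP // e; have := adj_neq ai; rewrite e /= eqxx.
Qed.

Lemma third_adjP (i : incidence G) (x : element G) : third_adj (inr i) x ->
  x = inl (inc_vertex i) \/
  exists j, [/\ x = inr j, inc_vertex j = far_end i & far_end j = inc_vertex i].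
Proof.
case: x => [u /= /eqP<-|j /= /andP[/eqP eij ij]]; first by left.
by right; exists j; have [] := inc_edge_eq eij ij.
Qed.

Lemma third_adj_vertex (u : G) (x : element G) : third_adj (inl u) x ->
  exists2 i, x = inr i & inc_vertex i = u.
Proof. by case: x => [//|i] /= /eqP <-; exists i. Qed.

Lemma dist_leS (T : eqType) (r : rel T) n x y : dist_le r n.+1 x y ->
  x = y \/ exists2 z, r x z & dist_le r n z y.
Proof.
move=> [[|z p] [/= pth lst sz]]; first by left.
by case/andP: pth => xz zp; right; exists z => //; exists p.
Qed.

Lemma dist_le0 (T : eqType) (r : rel T) x y : dist_le r 0 x y -> x = y.
Proof. by move=> [[|z p] []]. Qed.

Lemma dist_le_sym (T : eqType) (r : rel T) n x y : symmetric r ->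
  dist_le r n x y -> dist_le r n y x.
Proof.
move=> rs [p [pth <- sz]]; exists (rev (belast x p)); split.
- by rewrite rev_path; rewrite (eq_path (e' := r)) // => a b; rewrite rs.
- by case: p {pth sz} => [//|z p] /=; rewrite rev_cons last_rcons.
- by rewrite size_rev size_belast.
Qed.

Lemma dist_le2_vertex (u : G) (y : element G) : dist_le (@third_adj G) 2 (inl u) y ->
  y = inl u \/ exists2 i, y = inr i & inc_vertex i = u \/ far_end i = u.
Proof.
move=> /dist_leS[<-|[_ /third_adj_vertex[i -> iu]]]; first by left.
move=> /dist_leS[<-|[z + /dist_le0 <-]]; first by right; exists i; auto.
move=> /third_adjP[->|[j [-> jv jf]]]; first by left; rewrite iu.
by right; exists j => //; right; rewrite jf.
Qed.

Lemma dist_le2_incidence (i : incidence G) (y : element G) :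
  dist_le (@third_adj G) 2 (inr i) y ->
  (exists2 v, y = inl v & v = inc_vertex i \/ v = far_end i) \/
  exists2 j, y = inr j & inc_vertex j = inc_vertex i \/
    (inc_vertex j = far_end i /\ far_end j = inc_vertex i).
Proof.
move=> /dist_leS[<-|[_ /third_adjP[->|[j [-> jv jf]]]]].
- by right; exists i; auto.
- move=> /dist_leS[<-|[_ /third_adj_vertex[j -> jv] /dist_le0 <-]].
    by left; exists (inc_vertex i); auto.
  by right; exists j; auto.
- move=> /dist_leS[<-|[z + /dist_le0 <-]]; first by right; exists j; auto.
  move=> /third_adjP[->|[k [-> kv kf]]]; first by left; exists (inc_vertex j); auto.
  by right; exists k => //; left; rewrite kv.
Qed.

Lemma third_adj_sym : symmetric (@third_adj G).
Proof.
case=> [x|x] [y|y] //=.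
by rewrite [inc_edge x == _]eq_sym [x == y]eq_sym.
Qed.

(** Two incidences at distance at most 3 share their vertex, or the vertex of one is the far end of
    the other. In the first case their far ends have a common neighbour, in the second they are
    adjacent, so [f] separates them. *)
Lemma pair_coloring_colorable K (c f : G -> 'I_K) :
  pair_coloring setT c f -> ks_colorable G 1 K.
Proof.
move=> [g1 g2 g3].
have {}g1 u : c u != f u by exact: g1.
have {}g2 u v : adj u v -> [/\ c u != c v, f u != f v & c u != f v] by move=> uv; exact: g2.
have {}g3 w u v : adj w u -> adj w v -> u != v -> f u != f v.
  by move=> wu wv; apply: (g3 w).
pose col (x : element G) := match x with inl v => c v | inr i => f (far_end i) end.
have inlr u i : inc_vertex i = u \/ far_end i = u -> c u != f (far_end i).
  have [_ ai] := far_endP i; case=> <- //; by case: (g2 _ _ ai).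
have inrr i j : i != j -> [\/ inc_vertex i = inc_vertex j, inc_vertex j = far_end i
    | inc_vertex i = far_end j] -> f (far_end i) != f (far_end j).
  have [_ ai] := far_endP i; have [_ aj] := far_endP j => ij [e|e|e].
  - apply: (g3 (inc_vertex i)) => //; first by rewrite e.
    by apply: contra_neq ij; exact: incidence_eq.
  - by rewrite -e; case: (g2 _ _ aj).
  - by rewrite -e eq_sym; case: (g2 _ _ ai).
exists col; split; last first.
  move=> v; rewrite -(cards1 (f v)); apply/subset_leq_card/subsetP.
  move=> _ /imsetP[i iv ->]; rewrite inE /=; apply/eqP; congr (f _).
  move: iv; rewrite inE => /andP[_ /eqP ev]; have [eo ai] := far_endP i.
  have : far_end i \in [set inc_vertex i; v] by rewrite -ev eo set22.
  by rewrite in_set2 eq_sym (negPf (adj_neq ai)) => /eqP.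
have vx u y : inl u != y -> dist_le (@third_adj G) 3 (inl u) y -> col (inl u) != col y.
  move=> uy /dist_leS[e|[_ /third_adj_vertex[i -> iu] /dist_le2_incidence]].
    by rewrite e eqxx in uy.
  have [_ ai] := far_endP i.
  case=> [[v yv [vi|vi]]|[j -> [jv|[jv jf]]]].
  - by rewrite yv vi iu eqxx in uy.
  - by rewrite yv vi -iu /=; case: (g2 _ _ ai).
  - by apply: inlr; left; rewrite jv.
  - by apply: inlr; right; rewrite jf.
case=> [u|i] [v|j] xy dxy; [exact: vx|exact: vx| |].
  by rewrite eq_sym; apply: vx; [rewrite eq_sym|exact: dist_le_sym third_adj_sym dxy].
apply: inrr; first by apply: contraNneq xy => ->.
move: dxy => /dist_leS[e|[_ /third_adjP[->|[k [-> kv kf]]]]].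
- by rewrite e eqxx in xy.
- move=> /dist_le2_vertex[//|[k [->] [e|e]]]; [constructor 1|constructor 3]; by rewrite e.
- move=> /dist_le2_incidence[[w //]|[l [->] [e|[e1 e2]]]].
    by constructor 2; rewrite e.
  by constructor 1; rewrite e1.
Qed.

(** A vertex [v] of maximum degree, the incidences at [v], and one incidence of $I_2(v)$ are
    pairwise at distance at most 3. *)
Lemma max_degree_lower_bound K : 0 < max_degree G -> ks_colorable G 1 K ->
  max_degree G + 2 <= K.
Proof.
move=> D0 [c [prop _]].
have [v Dv] : exists v : G, max_degree G = #|neighbors v|.
  have : 0 < #|G|.
    rewrite lt0n; apply: contraTneq D0 => /card0_eq G0; rewrite /max_degree big1 // => v.
    by have := G0 v; rewrite inE.
  by rewrite /max_degree => /(eq_bigmax (fun v : G => #|neighbors v|))[v ->]; exists v.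
have [u0] : exists u, u \in neighbors v by apply/set0Pn; rewrite -card_gt0 -Dv.
rewrite inE => vu0; have [i0 [i0u i0v]] := incidence_ex (etrans (adj_sym _ _) vu0).
pose Q := inl v |: (inr i0 |: [set inr i | i in [set i | inc_vertex i == v]] : {set element G}).
have uv : u0 != v by rewrite eq_sym adj_neq.
have cQ : #|Q| = #|[set i : incidence G | inc_vertex i == v]| + 2.
  rewrite cardsU1 cardsU1 card_imset; last by move=> ? ? [].
  have -> : inl v \notin inr i0 |: [set inr i | i in [set i | inc_vertex i == v]].
    by rewrite in_setU1 /=; apply/imsetP => -[].
  have -> : inr i0 \notin [set (inr i : element G) | i in [set i | inc_vertex i == v]].
    by apply/imsetP => -[i + [e]]; rewrite -e inE i0u (negPf uv).
  by rewrite /= !add1n addn2.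
have cN : #|neighbors v| <= #|[set i : incidence G | inc_vertex i == v]|.
  have -> : neighbors v = [set far_end i | i in [set i : incidence G | inc_vertex i == v]].
    apply/setP => u; rewrite inE; apply/idP/imsetP => [vu|[i + ->]].
      by have [i [iv <-]] := incidence_ex vu; exists i => //; rewrite inE iv.
    by rewrite inE => /eqP <-; case: (far_endP i).
  exact: leq_imset_card.
have third_i (i : incidence G) : inc_vertex i == v -> third_adj (inl v) (inr i).
  by move=> iv; rewrite /= iv.
(* [j0] is the other half of the edge of [i0]; short walks from [i0] to the rest of [Q] pass through
   it. *)
have [j0 [j0v j0u]] := incidence_ex vu0.
have j0i0 : third_adj (inr j0 : element G) (inr i0).
  rewrite /=; have [-> _] := far_endP j0; have [-> _] := far_endP i0.
  rewrite i0u i0v j0u j0v setUC eqxx /=; apply: contraNneq uv => e.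
  by rewrite -i0u -e j0v.
have near (x : element G) : x \in Q ->
    [\/ x = inl v, x = inr i0 | exists2 i, x = inr i & inc_vertex i == v].
  rewrite in_setU1 => /orP[/eqP->|]; first by constructor 1.
  rewrite in_setU1 => /orP[/eqP->|/imsetP[i]]; first by constructor 2.
  by rewrite inE => iv ->; constructor 3; exists i.
have tv (i : incidence G) : inc_vertex i == v -> third_adj (inr i) (inl v : element G).
  by move=> iv; rewrite /= iv.
have j0' : inc_vertex j0 == v by rewrite j0v.
have i0j0 : third_adj (inr i0) (inr j0 : element G) by rewrite third_adj_sym.
have dist3 x y : x \in Q -> y \in Q -> x != y -> dist_le (@third_adj G) 3 x y.
  move=> /near[->|->|[i -> iv]] /near[->|->|[j -> jv]] xy; rewrite ?eqxx // in xy.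
  - by exists [:: inr j0; inr i0]; split=> //; rewrite /path j0i0 third_i.
  - by exists [:: inr j]; rewrite /= jv.
  - by exists [:: inr j0; inl v]; split=> //; rewrite /path i0j0 tv.
  - by exists [:: inr j0; inl v; inr j]; split=> //; rewrite /path i0j0 tv // third_i.
  - by exists [:: inl v]; rewrite /= iv.
  - by exists [:: inl v; inr j0; inr i0]; split=> //; rewrite /path j0i0 tv // third_i.
  - by exists [:: inl v; inr j]; split=> //; rewrite /path tv // third_i.
have inj : {in Q &, injective c}.
  move=> x y xQ yQ e; apply/eqP; apply: contraT => xy.
  by have := prop x y xy (dist3 x y xQ yQ xy); rewrite e eqxx.
rewrite Dv; apply: leq_trans (_ : #|Q| <= K); first by rewrite cQ leq_add2r.
by rewrite -(card_in_imset inj) -[X in _ <= X]card_ord max_card.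
Qed.
End Incidences.

Lemma closed_ear_cycle (G : sgraph) (U : {set G}) m : 1 < m < 4 -> closed_ear U m ->
  exists2 c : seq G, is_cycle c & size c < 6.
Proof.
move=> m24 [x [s [y [sz [u1 u2 sU H] xy axy _]]]].
have adjN p a b : nbhd_in U p = [set a; b] -> adj a p /\ adj p b.
  move=> N; have := set21 a b; have := set22 a b; rewrite -N !inE.
  by move=> /andP[_ ->] /andP[_]; rewrite adj_sym.
exists (x :: rcons s y); last by rewrite /= size_rcons sz; lia.
apply/and3P; split; first by rewrite /= size_rcons sz; lia.
  rewrite -rcons_cons rcons_uniq u1 andbT; move: u2; rewrite rcons_uniq => /andP[ys _].
  by rewrite inE negb_or eq_sym xy.
have ayx : adj y x by rewrite adj_sym.
case: s sz H {u1 u2 sU} => [|p1 [|p2 [|p3 [|p4 s]]]] /= sz H; try by exfalso; lia.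
  have [-> _] := adjN _ _ _ (H 0 isT); have [-> ->] := adjN _ _ _ (H 1 isT).
  by rewrite ayx.
have [-> _] := adjN _ _ _ (H 0 isT); have [-> _] := adjN _ _ _ (H 1 isT).
by have [-> ->] := adjN _ _ _ (H 2 isT); rewrite ayx.
Qed.

(** * Drawings in the plane *)

From mathcomp Require Import all_order all_algebra.
From mathcomp Require Import all_classical all_reals all_analysis.
From mathcomp Require Import lra.
Import Order.TTheory GRing.Theory Num.Theory.
Import numFieldNormedType.Exports.

Section Plane.
Local Open Scope classical_set_scope.
Local Open Scope ring_scope.
Variable R : realType.
Implicit Types (p q r s : R * R) (X Y : set (R * R)) (eta : R).

Definition boxclose eta : rel (R * R) :=
  fun p q => (`|p.1 - q.1| < eta) && (`|p.2 - q.2| < eta).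

(** Breaking ties by the other coordinate makes any two distinct points comparable in both senses,
    so sampled points need not be in general position. *)
Definition lex1 : rel (R * R) :=
  fun p q => (p.1 < q.1) || ((p.1 == q.1) && (p.2 < q.2)).
Definition lex2 : rel (R * R) :=
  fun p q => (p.2 < q.2) || ((p.2 == q.2) && (p.1 < q.1)).

Lemma boxclosexx eta p : 0 < eta -> boxclose eta p p.
Proof. by move=> e0; rewrite /boxclose !subrr normr0 e0. Qed.

Lemma boxcloseC eta p q : boxclose eta p q = boxclose eta q p.
Proof. by rewrite /boxclose distrC (distrC p.2). Qed.

Lemma boxclose_trans e1 e2 p q r : boxclose e1 p q -> boxclose e2 q r -> boxclose (e1 + e2) p r.
Proof.
move=> /andP[a1 a2] /andP[b1 b2]; apply/andP; split.
  by rewrite -(subrKA q.1); apply: le_lt_trans (ler_normD _ _) (ltrD _ _).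
by rewrite -(subrKA q.2); apply: le_lt_trans (ler_normD _ _) (ltrD _ _).
Qed.

Lemma boxclose_le e1 e2 p q : e1 <= e2 -> boxclose e1 p q -> boxclose e2 p q.
Proof. by move=> le12 /andP[h1 h2]; rewrite /boxclose !(lt_le_trans _ le12). Qed.

Lemma neq_opposed p r : p != r -> opposed lex1 lex2 p r.
Proof.
case: p r => p1 p2 [r1 r2]; rewrite xpair_eqE /opposed /lex1 /lex2 /=.
by case: (ltgtP p1 r1); case: (ltgtP p2 r2).
Qed.

(** A meeting point has the ordinate of [p] and the abscissa of [s]. It lies within [eta] of both
    along the two steps, so [p] and [s] themselves would be close. *)
Lemma step_crossing_far eta p q r s :
  boxclose eta p q -> boxclose eta r s -> ~~ boxclose eta p s ->
  step_crossing lex1 lex2 p q r s = false.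
Proof.
move=> /andP[pq _] /andP[_ rs] nps; apply/negbTE; apply: contra nps.
rewrite /step_crossing /lex1 /lex2 /boxclose => /andP[].
case: p q r s pq rs => p1 p2 [q1 q2] [r1 r2] [s1 s2] /=.
rewrite !ltr_norml => /andP[a1 a2] /andP[b1 b2] H1 H2.
have {}H1 : ((p1 <= s1) && (s1 <= q1)) || ((q1 <= s1) && (s1 <= p1)).
  by move: H1; case: (ltgtP p1 s1); case: (ltgtP q1 s1).
have {}H2 : ((p2 <= s2) && (r2 <= p2)) || ((s2 <= p2) && (p2 <= r2)).
  by move: H2; case: (ltgtP p2 s2); case: (ltgtP r2 p2).
case/orP: H1 => /andP[c1 c2]; case/orP: H2 => /andP[d1 d2];
  by apply/andP; split; apply/andP; split; lra.
Qed.

Definition apart eta : seq (R * R) -> seq (R * R) -> bool :=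
  allrel (fun p r => ~~ boxclose eta p r).

Lemma crossing_apart eta p e r f :
  path (boxclose eta) p e -> path (boxclose eta) r f -> apart eta (p :: e) (r :: f) ->
  crossing lex1 lex2 p e r f = false.
Proof.
move=> pe rf ap; rewrite /crossing.
elim: e p pe ap => [|q e IH] p //= /andP[pq qe]; rewrite /apart allrel_consl.
move=> /andP[ap aq]; rewrite (IH q) // Bool.xorb_false_r.
elim: f r rf ap {aq IH} => [|s f IHf] r //= /andP[rs sf] /andP[_ aps].
rewrite (IHf s sf) //.
by move: aps => /= /andP[aps _]; rewrite (step_crossing_far pq rs aps).
Qed.

Theorem k33_chains eta (A P : 'I_3 -> R * R) (E : 'I_3 -> 'I_3 -> seq (R * R)) :
  0 < eta ->
  (forall i j, path (boxclose eta) (A i) (E i j)) ->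
  (forall i j, last (A i) (E i j) = P j) ->
  (forall i j k l, i != k -> j != l ->
     apart eta (A i :: E i j) (A k :: E k l)) -> False.
Proof.
move=> eta0 pE lE apE; apply: (@k33_crossing _ lex1 lex2 A P E lE) => i j k l ik jl.
  apply/allrelP => x y xE yE; apply: neq_opposed.
  have := allrelP (apE i j k l ik jl) x y xE yE.
  by apply: contraNneq => ->; rewrite boxclosexx.
exact: crossing_apart (pE i j) (pE k l) (apE i j k l ik jl).
Qed.

Definition chained eta X p q :=
  exists e, [/\ path (boxclose eta) p e, last p e = q & {in p :: e, forall x, X x}].

Lemma chained_refl eta X p : X p -> chained eta X p p.
Proof. by move=> Xp; exists [::]; split=> // x; rewrite inE => /eqP->. Qed.

Lemma chained_trans eta X p q r : chained eta X p q -> chained eta X q r -> chained eta X p r.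
Proof.
move=> [e [pe lpe Xe]] [f [qf lqf Xf]]; exists (e ++ f).
split; rewrite ?cat_path ?last_cat ?lpe ?pe // => x.
rewrite -cat_cons mem_cat => /orP[/Xe//|xf]; apply: Xf.
by rewrite inE xf orbT.
Qed.

Lemma chained_step eta X p q : X p -> X q -> boxclose eta p q -> chained eta X p q.
Proof.
move=> Xp Xq pq; exists [:: q]; split; rewrite /= ?pq // => x.
by rewrite !inE => /orP[] /eqP->.
Qed.

Lemma chained_sub eta X Y p q : X `<=` Y -> chained eta X p q -> chained eta Y p q.
Proof. by move=> XY [e [pe le Xe]]; exists e; split=> // x /Xe/XY. Qed.

Lemma nbhs_boxcloseP p X :
  nbhs p X <-> exists2 eta, 0 < eta & forall q, boxclose eta p q -> X q.
Proof.
split.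
  move=> /nbhs_ballP[eta /= eta0 H]; exists eta => // q /andP[h1 h2].
  by apply: H; split; rewrite /ball /=.
move=> [eta eta0 H]; apply/nbhs_ballP; exists eta => //= q [h1 h2].
by apply: H; rewrite /boxclose; apply/andP; split.
Qed.

(** [Q] is locally constant on [F], so [Q] and its complement are both relatively open in [F]. *)
Lemma connected_spread (T : topologicalType) (F Q : set T) (x : T) :
  connected F -> F x -> Q x ->
  (forall y, F y -> exists2 N, nbhs y N &
     forall u v, F u -> F v -> N u -> N v -> Q u -> Q v) ->
  F `<=` Q.
Proof.
move=> Fc Fx Qx H.
pose stable (N : set T) := forall u v, F u -> F v -> N u -> N v -> Q u -> Q v.
pose O (B : set T) :=
  \bigcup_(N in [set N | open N /\ stable N /\ (exists2 z, F z & B z /\ N z)]) N.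
have oO B : open (O B) by apply: bigcup_open => N [].
have cov B y : F y -> B y -> O B y.
  move=> Fy By; have [N yN HN] := H y Fy; exists N^° => /=; last exact: yN.
  split; first exact: open_interior.
  split; last by exists y => //; split=> //; exact: yN.
  by move=> u v Fu Fv /interior_subset Nu /interior_subset Nv; exact: HN.
suff : F `&` Q = F by move=> <- y [].
apply: Fc.
- by exists x.
- exists (O Q) => //; apply/seteqP; split=> y [Fy]; first by split=> //; exact: cov.
  move=> [N [_ [HN [z Fz [Qz Nz]]]] Ny]; split=> //; exact: HN Qz.
- exists (~` O (~` Q)); first exact: open_closedC.
  apply/seteqP; split=> y [Fy Qy]; split=> //.
    by move=> [N [_ [HN [z Fz [Qz Nz]]]] Ny]; apply: Qz; exact: HN Qy.
  by apply: contrapT => nQ; apply: Qy; exact: cov.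
Qed.

Lemma connected_chained eta X p q :
  0 < eta -> connected X -> X p -> X q -> chained eta X p q.
Proof.
move=> eta0 cX Xp Xq.
apply: (connected_spread (Q := chained eta X p) cX Xp) Xq; first exact: chained_refl.
move=> y Xy; exists (boxclose (eta / 2) y).
  by apply/nbhs_boxcloseP; exists (eta / 2) => //; rewrite divr_gt0.
move=> u v Xu Xv Nu Nv pu; apply: (chained_trans pu); apply: chained_step => //.
rewrite [eta]splitr; apply: boxclose_trans Nv; by rewrite boxcloseC.
Qed.

Lemma k33_sets eta (A P : 'I_3 -> R * R) (X : 'I_3 -> 'I_3 -> set (R * R)) :
  0 < eta ->
  (forall i j, chained eta (X i j) (A i) (P j)) ->
  (forall (i j k l : 'I_3) p q, (i < k)%N -> j != l ->
     X i j p -> X k l q -> ~~ boxclose eta p q) ->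
  False.
Proof.
move=> eta0 ch sep.
have [E HE] := choice (fun ij : 'I_3 * 'I_3 => ch ij.1 ij.2).
apply: (@k33_chains eta A P (fun i j => E (i, j)) eta0).
- by move=> i j; have [] := HE (i, j).
- by move=> i j; have [] := HE (i, j).
move=> i j k l ik jl; have [_ _ Xij] := HE (i, j); have [_ _ Xkl] := HE (k, l).
apply/allrelP => p q pE qE.
case: (ltngtP i k) => [lt_ik|lt_ki|/val_inj eik].
- exact: sep lt_ik jl (Xij _ pE) (Xkl _ qE).
- by rewrite boxcloseC; apply: sep lt_ki _ (Xkl _ qE) (Xij _ pE); rewrite eq_sym.
- by rewrite eik eqxx in ik.
Qed.

Lemma finite_small (I : finType) (P : I -> R -> Prop) :
  (forall i e e', e' <= e -> P i e -> P i e') ->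
  (forall i, exists2 e, 0 < e & P i e) ->
  exists2 e, 0 < e & forall i, P i e.
Proof.
move=> Pmono H.
have {}H i : exists e, 0 < e /\ P i e by have [e e0 Pe] := H i; exists e.
have [e He] := choice H.
exists (\big[Order.min/1]_i e i).
  by apply: (big_ind (fun x => 0 < x)) => // [x y x0 y0|i _]; [rewrite lt_min x0|case: (He i)].
move=> i; apply: (Pmono i (e i)); last by case: (He i).
exact: bigmin_le_cond.
Qed.

Lemma compact_apart X Y : compact X -> closed Y -> (forall p, X p -> ~ Y p) ->
  exists2 eta, 0 < eta & forall p q, X p -> Y q -> ~~ boxclose eta p q.
Proof.
move=> /compact_near_coveringP cX cY dXY.
(* Compactness in its near-covering form, with the separation [eta] tending to 0 as parameter. *)
have [|e /= e0 He] := cX R (nbhs (0 : R))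
    (fun eta p => forall q, Y q -> ~~ boxclose eta p q) _.
  move=> p Xp; have : nbhs p (~` Y).
    by apply: open_nbhs_nbhs; split; [exact: closed_openC|exact: dXY].
  move=> /nbhs_boxcloseP[e e0 He]; have e20 : 0 < e / 2 by rewrite divr_gt0.
  exists ([set q : R * R | boxclose (e / 2) p q], ball (0 : R) (e / 2)) => /=.
    by split; [apply/nbhs_boxcloseP; exists (e / 2)|exact: nbhsx_ballx].
  move=> [p' t] [/= pp' te] q Yq; apply/negP => p'q.
  apply: (He q) => //; rewrite [e]splitr; apply: (boxclose_trans pp').
  apply: boxclose_le p'q; move: te; rewrite /ball /= sub0r normrN => te.
  by rewrite (le_trans (ler_norm _)) ?ltW.
exists (e / 2); first by rewrite divr_gt0.
move=> p q Xp Yq; apply: (He (e / 2)) => //=.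
by rewrite sub0r normrN gtr0_norm ?divr_gt0 // ltr_pdivrMr // ltr_pMr // ltr1n.
Qed.

Lemma segment_between (x y t : R) : 0 <= t <= 1 ->
  Order.min x y <= x + t * (y - x) <= Order.max x y.
Proof.
move=> /andP[t0 t1]; rewrite ge_min le_max.
case: (leP x y) => xy; apply/andP; split; apply/orP; [left|right|right|left]; nra.
Qed.

(** A box is convex, so the segment from [u] to [v] stays in it. *)
Lemma chained_box eta e p u v : 0 < eta -> boxclose e p u -> boxclose e p v ->
  chained eta (boxclose e p) u v.
Proof.
move=> eta0 pu pv.
pose f (t : R) : R * R := (u.1 + t * (v.1 - u.1), u.2 + t * (v.2 - u.2)).
pose S := f @` [set` `[0, 1]%R].
have cl (x y : R) : continuous (fun t : R => x + t * (y - x)).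
  move=> t; apply: cvgD; first exact: cvg_cst.
  by apply: cvgM; [exact: cvg_id|exact: cvg_cst].
have cf : continuous f by move=> t; exact: cvg_pair (cl u.1 v.1 t) (cl u.2 v.2 t).
have cS : connected S.
  apply: connected_continuous_connected; first exact: segment_connected.
  exact: continuous_subspaceT.
have SN : S `<=` boxclose e p.
  move=> _ [t + <-]; rewrite /= in_itv /= => t01.
  move: pu pv => /andP[]; rewrite /boxclose /= !ltr_norml.
  move=> /andP[a1 a2] /andP[a3 a4] /andP[/andP[b1 b2] /andP[b3 b4]].
  have := segment_between u.1 v.1 t01; have := segment_between u.2 v.2 t01.
  rewrite !ge_min !le_max => /andP[/orP c1 /orP c2] /andP[/orP c3 /orP c4].
  apply/andP; split; apply/andP; split; [case: c4|case: c3|case: c2|case: c1] => *; lra.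
apply: (chained_sub SN); apply: connected_chained => //.
  by exists 0; rewrite /= ?in_itv /= ?lexx ?ler01 // /f !mul0r !addr0; case: (u).
exists 1; rewrite /= ?in_itv /= ?lexx ?ler01 // /f !mul1r !subrKC; case: (v) => //.
Qed.
End Plane.

(** * Separation of disjoint parts of a drawing *)

Section Drawing.
Local Open Scope classical_set_scope.
Local Open Scope ring_scope.
Variables (R : realType) (G : sgraph) (pt : G -> R * R) (ar : {set G} -> set (R * R)).
Hypothesis draw : planar_drawing pt ar.

(** Diagonal pairs stand for vertices and adjacent pairs for edges, so one finite type indexes all
    pieces of the drawing. *)
Definition cell_index (uv : G * G) := (uv.1 == uv.2) || adj uv.1 uv.2.

Definition cell (uv : G * G) : set (R * R) :=
  if uv.1 == uv.2 then [set pt uv.1] else ar [set uv.1; uv.2]%SET.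

Lemma cell_arc uv : cell_index uv ->
  [/\ compact (cell uv), connected (cell uv), cell uv (pt uv.1) & cell uv (pt uv.2)].
Proof.
case: uv => u v; rewrite /cell_index /cell /=; case: eqVneq => [-> _|uv /= auv].
  by split; [exact: compact_set1|exact: connected1| |].
have [_ /(_ u v auv)[f [cf _ f0 f1 <-]] _ _] := draw.
have i0 : `[0 : R, 1]%classic 0 by rewrite /= in_itv /= lexx ler01.
have i1 : `[0 : R, 1]%classic 1 by rewrite /= in_itv /= lexx ler01.
split; [|apply: connected_continuous_connected => //; exact: segment_connected|..].
- by apply: continuous_compact => //; exact: segment_compact.
- by exists 0.
- by exists 1.
Qed.

Lemma cell_support uv : cell_index uv -> cell uv `<=` drawing_support pt ar.
Proof.
case: uv => u v; rewrite /cell_index /cell /=; case: eqVneq => [-> _|uv /= auv] x.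
  by move=> ->; left; exists v.
by move=> ux; right; exists [set u; v]%SET => //; exact: edge_edges.
Qed.

Lemma cell_disjoint (uv xy : G * G) p : cell_index uv -> cell_index xy ->
  uv.1 \notin [:: xy.1; xy.2] -> uv.2 \notin [:: xy.1; xy.2] ->
  cell uv p -> cell xy p -> False.
Proof.
case: uv xy => u v [x y] /= iuv ixy; rewrite !inE !negb_or.
move=> /andP[ux uy] /andP[vx vy]; move: iuv ixy; rewrite /cell_index /cell /=.
have [pti _ c3 c4] := draw.
case: eqVneq => [_ _|uv /= auv]; case: eqVneq => [_ _|xy /= axy].
- by move=> -> /pti eux; rewrite eux eqxx in ux.
- move=> -> /(c3 _ _ (edge_edges axy)).
  by rewrite !inE (negPf ux) (negPf uy).
- move=> + px; rewrite px => /(c3 _ _ (edge_edges auv)).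
  by rewrite !inE eq_sym (negPf ux) eq_sym (negPf vx).
- have neq : [set u; v]%SET != [set x; y]%SET.
    apply/eqP => /setP/(_ u); rewrite !inE eqxx /=.
    by rewrite (negPf ux) (negPf uy).
  move=> h1 h2.
  have [w] := c4 _ _ (edge_edges auv) (edge_edges axy) neq p h1 h2.
  rewrite !inE => /andP[/orP[]/eqP->]; by rewrite ?(negPf ux, negPf uy, negPf vx, negPf vy).
Qed.

Definition carrier (X : pred G) : set (R * R) :=
  [set p | exists uv, [/\ cell_index uv, X uv.1, X uv.2 & cell uv p]].

(** Cells without a common vertex are disjoint compact sets, and there are finitely many pairs of
    them, so one [eta] serves all. *)
Lemma cells_apart : exists2 eta : R, 0 < eta & forall (X Y : pred G) p q,
  (forall x, X x -> Y x -> False) -> carrier X p -> carrier Y q -> ~~ boxclose eta p q.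
Proof.
pose P (i : (G * G) * (G * G)) (eta : R) := cell_index i.1 -> cell_index i.2 ->
  i.1.1 \notin [:: i.2.1; i.2.2] -> i.1.2 \notin [:: i.2.1; i.2.2] ->
  forall p q, cell i.1 p -> cell i.2 q -> ~~ boxclose eta p q.
have [||eta eta0 H] := @finite_small R _ P.
- move=> i e e' le h a b c d p q cp cq; apply: contra (h a b c d p q cp cq).
  exact: boxclose_le.
- move=> [uv xy]; rewrite /P /=.
  case: (boolP [&& cell_index uv, cell_index xy, uv.1 \notin [:: xy.1; xy.2]
     & uv.2 \notin [:: xy.1; xy.2]]); last first.
    move=> nh; exists 1 => // a b c d; by rewrite a b c d in nh.
  move=> /and4P[a b c d].
  have [k1 _ _ _] := cell_arc a; have [k2 _ _ _] := cell_arc b.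
  have [|eta e0 h] := compact_apart k1 (compact_closed (@norm_hausdorff R _) k2).
    by move=> p h1 h2; exact: cell_disjoint a b c d h1 h2.
  by exists eta.
exists eta => // X Y p q XY [uv [iuv X1 X2 cp]] [xy [ixy Y1 Y2 cq]].
apply: (H (uv, xy)) cp cq => //=; apply/negP; rewrite !inE => /orP[]/eqP e.
- by apply: (XY uv.1) => //; rewrite e.
- by apply: (XY uv.1) => //; rewrite e.
- by apply: (XY uv.2) => //; rewrite e.
- by apply: (XY uv.2) => //; rewrite e.
Qed.

Lemma linked_chained eta X u v : 0 < eta -> linked X u v ->
  chained eta (carrier X) (pt u) (pt v).
Proof.
move=> eta0 [p [pth <- aX]]; elim: p u pth aX => [|w p IH] u /=.
  move=> _ /andP[Xu _]; apply: chained_refl.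
  by exists (u, u); split; rewrite /cell_index /cell //= eqxx.
move=> /andP[uw wp] /andP[Xu aX]; apply: chained_trans (IH w wp aX).
have iuw : cell_index (u, w) by rewrite /cell_index /= uw orbT.
have [_ cc c1 c2] := cell_arc iuw.
apply: chained_sub (connected_chained eta0 cc c1 c2) => x cx.
by exists (u, w); split=> //=; case/andP: aX.
Qed.
End Drawing.

(** * Outerplanar graphs have no theta *)

Section Outerplanar.
Local Open Scope classical_set_scope.
Local Open Scope ring_scope.

Lemma drawing_support_far (R : realType) (G : sgraph) (pt : G -> R * R) ar y :
  planar_drawing pt ar -> ~ drawing_support pt ar y ->
  exists2 e, 0 < e & forall p, drawing_support pt ar p -> ~~ boxclose e y p.
Proof.
move=> draw ny.
pose P (uv : G * G) (e : R) := cell_index uv -> forall p, cell pt ar uv p -> ~~ boxclose e y p.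
have [||e e0 H] := @finite_small R _ P.
- move=> i e e' le h a p cp; apply: contra (h a p cp); exact: boxclose_le.
- move=> uv; rewrite /P; case: (boolP (cell_index uv)) => iuv; last by exists 1.
  have [k _ _ _] := cell_arc draw iuv.
  have cl := compact_closed (@norm_hausdorff R _) k.
  have [|e e0 h] := @compact_apart R [set y] _ (@compact_set1 _ y) cl.
    by move=> _ -> cy; apply: ny; exact: cell_support cy.
  by exists e => // _ p cp; exact: h.
exists e => // p [[v ->]|[_ /imsetP[[u v] /= + ->] cp]].
  by apply: (H (v, v)); rewrite /cell_index /cell /= eqxx.
rewrite inE /= => auv; have neq : u != v by apply: contraTneq auv => ->; rewrite adj_irrefl.
by apply: (H (u, v)); rewrite /cell_index /cell /= (negPf neq).
Qed.

Theorem outerplanar_theta_free (R : realType) (G : sgraph) :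
  outerplanar R G -> theta_free G.
Proof.
move=> [pt [ar [draw [F [[x0 nx0 FE] _] clF]]]] a b p A B linkA linkB AB.
have cF : connected F by rewrite FE; exact: component_connected.
have FS y : F y -> ~ drawing_support pt ar y.
  by rewrite FE; exact: connected_component_sub.
have [eta0 eta0_gt0 sep] := cells_apart draw.
have [z Fz] : F !=set0 by have [z [Fz _]] := clF a setT filterT; exists z.
pose clear e : set (R * R) := [set q | forall x, drawing_support pt ar x -> ~~ boxclose e q x].
have clear_le e e' : e' <= e -> clear e `<=` clear e'.
  by move=> le q cq x sx; apply: contra (cq x sx); exact: boxclose_le.
(* The clearance [e] is fixed before the mesh [eta], so that the mesh can later be taken below the
   clearance. *)
pose Q y := exists2 e, 0 < e & forall eta, 0 < eta -> chained eta (clear e) z y.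
have half y e q : 0 < e -> (forall p, drawing_support pt ar p -> ~~ boxclose e y p) ->
   boxclose (e / 2) y q -> clear (e / 2) q.
  move=> e0 H yq x sx; apply: contra (H x sx) => qx.
  by rewrite [e]splitr; exact: boxclose_trans yq qx.
have FQ : F `<=` Q.
  apply: (connected_spread cF Fz).
    have [e e0 H] := drawing_support_far draw (FS z Fz).
    by exists e => // eta _; exact: chained_refl.
  move=> y Fy; have [e e0 H] := drawing_support_far draw (FS y Fy).
  have e20 : 0 < e / 2 by rewrite divr_gt0.
  exists [set q | boxclose (e / 2) y q].
    by apply/nbhs_boxcloseP; exists (e / 2).
  move=> u v Fu Fv yu yv [d d0 ch]; exists (Order.min d (e / 2)); first by rewrite lt_min d0.
  move=> eta eta_gt0; apply: chained_trans.
    by apply: chained_sub (ch eta eta_gt0); apply: clear_le; rewrite ge_min lexx.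
  apply: chained_sub (chained_box eta_gt0 yu yv) => q yq.
  by apply: (@clear_le (e / 2)); [rewrite ge_min lexx orbT|exact: half yq].
pose rho := eta0 / 2; have rho0 : 0 < rho by rewrite divr_gt0.
(* The middle vertices are only limits of points of the face, so each is approached at a point [q i]
   of [F], and the gap is bridged inside a small box. *)
have [q Hq] : {q : 'I_3 -> R * R & forall i, F (q i) /\ boxclose rho (pt (p i)) (q i)}.
  apply: (@choice _ _ (fun i q => F q /\ boxclose rho (pt (p i)) q)) => i.
  have [|q [Fq qi]] := clF (p i) [set q | boxclose rho (pt (p i)) q].
    by apply/nbhs_boxcloseP; exists rho.
  by exists q.
have [||e e0 He] := @finite_small R 'I_3
    (fun i e => forall eta, 0 < eta -> chained eta (clear e) z (q i)).
- by move=> i e e' le h eta /h; apply: chained_sub; exact: clear_le.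
- by move=> i; have [Fq _] := Hq i; exact: FQ Fq.
pose eta := Order.min e rho; have eta_gt0 : 0 < eta by rewrite lt_min e0.
have le_e : eta <= e by rewrite ge_min lexx.
have le_rho : eta <= rho by rewrite ge_min lexx orbT.
have le_eta0 : eta <= eta0 by rewrite (le_trans le_rho) // [leRHS]splitr lerDl ltW.
pose Z i : set (R * R) := clear e `|` [set y | boxclose rho (pt (p i)) y].
have zP i : chained eta (Z i) z (pt (p i)).
  have [_ qi] := Hq i; apply: chained_trans.
    by apply: chained_sub (He i eta eta_gt0) => y ?; left.
  apply: chained_sub (chained_box (p := pt (p i)) eta_gt0 qi _) => [y ?|]; first by right.
  exact: boxclosexx.
(* A point of [Z i] is either clear of the whole drawing, or within [rho] of [pt (p i)], which is
   [eta0] away from the carrier of [X]; both leave room for [eta]. *)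
have Zsep i (X Y : pred G) y x : Y (p i) -> (forall x, X x -> Y x -> False) ->
    carrier pt ar X x -> Z i y -> ~~ boxclose eta x y.
  move=> Yp XY Xx [cy|py].
    have sx : drawing_support pt ar x.
      by have [uv [iuv _ _ cx]] := Xx; exact: cell_support iuv _ cx.
    by rewrite boxcloseC; apply: contra (cy x sx); exact: boxclose_le.
  have : ~~ boxclose eta0 x (pt (p i)).
    apply: (sep X [pred w | w == p i]) => //.
      by move=> w Xw /= /eqP ew; apply: (XY w) => //; rewrite ew.
    by exists (p i, p i); split=> //=; rewrite /cell_index /cell /= eqxx.
  apply: contra => xy; rewrite [eta0]splitr; apply: boxclose_trans (_ : boxclose rho y _).
    exact: boxclose_le xy.
  by rewrite boxcloseC.
(* One side of the $K_{3,3}$ consists of [a], [b] and the face point [z], the other of the vertices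
   [p j]. *)
pose AA (i : 'I_3) := match val i with 0 => pt a | 1 => pt b | _ => z end.
pose XX (i j : 'I_3) := match val i with
  0 => carrier pt ar (A j) | 1 => carrier pt ar (B j) | _ => Z j end.
apply: (@k33_sets R eta AA (pt \o p) XX eta_gt0).
  case=> -[|[|[|//]]] Hi j; rewrite /XX /AA /=.
  - exact: linked_chained.
  - exact: linked_chained.
  - exact: zP.
case=> -[|[|[|//]]] Hi j [[|[|[|//]]] Hk] l x y //= _ jl; rewrite /XX /=.
- move=> Ax By; apply: contra (sep (A j) (B l) x y _ Ax By); first exact: boxclose_le.
  by move=> w; exact: AB.
- move=> Ax; apply: (Zsep l (A j) (B l)) => //; first exact: linked_mem (linkB l).
  by move=> w; exact: AB.
- move=> Bx; apply: (Zsep l (B j) (A l)) => //; first exact: linked_mem (linkA l).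
  by move=> w Bw Aw; apply: (AB l j w) => //; rewrite eq_sym.
Qed.

End Outerplanar.

(** * The three bounds *)

Lemma chi_vi_le (G : sgraph) (K : nat) : theta_free G ->
  (forall c : seq G, is_cycle c -> (4 <= size c)%N) ->
  (5 < K)%N -> (max_degree G + 2 <= K)%N ->
  (6 < K)%N \/ (forall c : seq G, is_cycle c -> (6 <= size c)%N) ->
  (chi_vi 1 G <= K)%N.
Proof.
move=> theta girth4 K6 degK K7; have [_] := @chi_viP G 1 isT; apply.
have tri (x y z : G) : adj x y -> adj y z -> adj x z -> False.
  move=> xy yz xz; have := girth4 [:: x; y; z]; rewrite /is_cycle /= xy yz adj_sym xz.
  by rewrite !inE negb_or (adj_neq xy) (adj_neq xz) (adj_neq yz) => /(_ isT).
have [||c [f good]] := @pair_coloring_ex G K theta tri K6 _ _ [set: G]%SET; last first.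
  exact: pair_coloring_colorable good.
  case: K7 => [|girth6]; [by left|right] => U m m24 /(closed_ear_cycle m24)[c /girth6].
  by lia.
move=> U x; apply: leq_trans degK; rewrite leq_add2r.
apply: leq_trans (_ : #|neighbors x| <= _)%N; last first.
  by rewrite /max_degree (bigD1 x) //= leq_maxl.
by apply/subset_leq_card/fintype.subsetP => y; rewrite !inE => /andP[].
Qed.

Theorem theorem2 (R : realType) (G : sgraph) (HG : outerplanar R G) :
  [/\ (4 <= max_degree G)%N -> (4%:E <= girth R G)%E ->
        (chi_vi 1 G <= max_degree G + 3)%N,
      (4 <= max_degree G)%N -> (6%:E <= girth R G)%E ->
        (chi_vi 1 G <= max_degree G + 2)%N,
      (5 <= max_degree G)%N -> (4%:E <= girth R G)%E ->
        (chi_vi 1 G <= max_degree G + 2)%N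
    & ((4 <= max_degree G)%N /\ (6%:E <= girth R G)%E) \/
      ((5 <= max_degree G)%N /\ (4%:E <= girth R G)%E) ->
        chi_vi 1 G = (max_degree G + 2)%N].
Proof.
have theta := outerplanar_theta_free HG.
have partA : (4 <= max_degree G)%N -> (4%:E <= girth R G)%E ->
    (chi_vi 1 G <= max_degree G + 3)%N.
  move=> D4 /girth_geP girth4; apply: chi_vi_le => //; [lia|lia|left; lia].
have partB : (4 <= max_degree G)%N -> (6%:E <= girth R G)%E ->
    (chi_vi 1 G <= max_degree G + 2)%N.
  (* There may be only six colours here; closed ears, being parts of cycles of length 4 or 5, are
     excluded by the girth. *)
  move=> D4 /girth_geP girth6; apply: chi_vi_le => //; [|lia|by right].
  by move=> c /girth6; exact: leq_trans.
have partC : (5 <= max_degree G)%N -> (4%:E <= girth R G)%E ->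
    (chi_vi 1 G <= max_degree G + 2)%N.
  move=> D5 /girth_geP girth4; apply: chi_vi_le => //; [lia|left; lia].
split=> // cases; apply/eqP; rewrite eqn_leq; apply/andP; split.
  by case: cases => -[]; [exact: partB|exact: partC].
apply: max_degree_lower_bound; first by case: cases => -[]; lia.
by have [] := @chi_viP G 1 isT.
Qed.
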